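(* Let $A$ be an infinite-dimensional pseudomatricial C$^*$-algebra. For every minimal projection $p\in A$ and every tracial state $\mathrm{tr}$ on $A$, $\mathrm{tr}(p)=0$. In particular, every infinite-dimensional pseudomatricial C$^*$-algebra has a non-faithful tracial state and is not simple.
   Context: A nonzero projection $p$ is minimal if it has no subprojection other than $0$ and $p$. $M_n$ denotes the C$^*$-algebra of complex $n\times n$ matrices, $n\ge 1$. Continuous logic for C$^*$-algebras: atomic formulae are norms $\|P(x_1,\dots,x_k)\|$ of $*$-polynomials with complex coefficients (a constant $I$ for the identity may be used when the algebras are unital); formulae are built from these by applying continuous real-valued functions to finitely many formulae and by taking $\sup$ or $\inf$ of a variable over the closed unit ball. A sentence is a formula without free variables; $\varphi^A\in\mathbb{R}$ is its value in $A$. $A\equiv B$ (elementarily equivalent) if $\varphi^A=\varphi^B$ for every sentence $\varphi$. For an ultrafilter $\mathcal{U}$ on a set $J$, the ultraproduct $\prod_{\mathcal{U}}A_i$ is the C$^*$-algebra of bounded families $(a_i)_{i\in J}$ modulo those with $\lim_{\mathcal{U}}\|a_i\|=0$. A C$^*$-algebra is pseudomatricial if it is elementarily equivalent to an ultraproduct of matrix algebras $M_n$. Such algebras are unital. *)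

(* Defs.v *)
From HB Require Import structures.
From mathcomp Require Import all_boot all_order all_algebra.
From mathcomp Require Import complex.
From mathcomp Require Import all_classical all_reals.
From mathcomp Require Import topology normedtype.
From mathcomp Require Import ring lra.

Set Implicit Arguments.
Unset Strict Implicit.
Unset Printing Implicit Defensive.

Import Order.TTheory GRing.Theory Num.Theory.
Import numFieldNormedType.Exports.

Local Open Scope classical_set_scope.
Local Open Scope complex_scope.
Local Open Scope ring_scope.

(** The complex numbers are [R[i]] for [R : realType], so the norm of a normed
    module over them takes its values in [R[i]]; [rnorm] below is the same norm
    as an element of [R].

    C*-algebras are not assumed to be unital.  The library has no structure for
    non-unital algebras, hence the separate product [cmul]. *)

HB.mixin Record isCStarAlgebra (R : realType) A
    & CompleteNormedModule R[i] A := {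
  cmul : A -> A -> A ;
  cstar : A -> A ;
  cmulA : associative cmul ;
  cmulDl : left_distributive cmul +%R ;
  cmulDr : right_distributive cmul +%R ;
  cmulZl : forall (c : R[i]) (a b : A), cmul (c *: a) b = c *: cmul a b ;
  cmulZr : forall (c : R[i]) (a b : A), cmul a (c *: b) = c *: cmul a b ;
  cstarK : involutive cstar ;
  cstarD : {morph cstar : a b / a + b} ;
  cstarZ : forall (c : R[i]) (a : A), cstar (c *: a) = c^* *: cstar a ;
  cstarM : forall a b : A, cstar (cmul a b) = cmul (cstar b) (cstar a) ;
  cnorm_mul : forall a b : A, `|cmul a b| <= `|a| * `|b| ;
  cnorm_cstar : forall a : A, `|cmul (cstar a) a| = `|a| ^+ 2 ;
}.

#[short(type="cstarAlgType")]
HB.structure Definition CStarAlgebra (R : realType) :=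
  {A of CompleteNormedModule R[i] A & isCStarAlgebra R A}.

Section real_norm.
Variables (R : realType).

Definition rnorm (V : normedZmodType R[i]) (x : V) : R := complex.Re `|x|.

Variable V : normedZmodType R[i].
Implicit Types x y : V.

Lemma rnormE x : (rnorm x)%:C = `|x|.
Proof.
rewrite /rnorm; have := normr_ge0 x; rewrite lecE => /andP[/eqP /= ].
by case: `|x| => a b /= ->.
Qed.

Lemma rnorm_ge0 x : 0 <= rnorm x.
Proof. by rewrite -(@lecR R) rnormE normr_ge0. Qed.

Lemma rnorm0 : rnorm (0 : V) = 0.
Proof. by rewrite /rnorm normr0. Qed.

Lemma rnorm_eq0 x : rnorm x = 0 -> x = 0.
Proof. by move=> x0; apply/eqP; rewrite -normr_eq0 -rnormE x0. Qed.

Lemma rnormD x y : rnorm (x + y) <= rnorm x + rnorm y.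
Proof. by rewrite -(@lecR R) rmorphD /= !rnormE ler_normD. Qed.

Lemma rnormN x : rnorm (- x) = rnorm x.
Proof. by rewrite /rnorm normrN. Qed.

Lemma rnormB x y : rnorm (x - y) = rnorm (y - x).
Proof. by rewrite -rnormN opprB. Qed.

End real_norm.

Section geometric_steps.
Variable R : realType.

Definition geom (n : nat) : R := 2 ^- n.

Lemma geom_gt0 n : 0 < geom n.
Proof. by rewrite invr_gt0 exprn_gt0. Qed.

Lemma geomS n : geom n = geom n.+1 *+ 2.
Proof.
by rewrite /geom exprS invfM -[RHS]mulr_natl mulrA divff ?mul1r// pnatr_eq0.
Qed.

Lemma geom_small (e : R) : 0 < e -> exists n, geom n < e.
Proof.
move=> e0; exists (Num.trunc e^-1).
rewrite /geom invf_plt ?posrE ?exprn_gt0//.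
apply: lt_le_trans (truncnS_gt _) _.
by rewrite -natrX ler_nat ltn_expl.
Qed.

Lemma geom_smallM (C e : R) : 0 < e -> exists n, C * geom n < e.
Proof.
move=> e0.
have C0 : 0 < `|C| + 1 by rewrite ltr_wpDl.
have [n hn] := geom_small (divr_gt0 e0 C0); exists n.
move: hn; rewrite ltr_pdivlMr// mulrC; apply: le_lt_trans.
by rewrite ler_wpM2r ?(ltW (geom_gt0 _))// (le_trans (ler_norm _))// lerDl.
Qed.

Definition steps (V : normedZmodType R[i]) (u : nat -> V) :=
  forall n, rnorm (u n.+1 - u n) <= geom n.

Lemma steps_dist (V : normedZmodType R[i]) (u : nat -> V) : steps u ->
  forall n m, (n <= m)%N -> rnorm (u m - u n) <= geom n *+ 2.
Proof.
move=> su n m /subnKC <-; set k := (m - n)%N.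
apply: (@le_trans _ _ (geom n *+ 2 - geom (n + k) *+ 2)); last first.
  by rewrite gerBl mulrn_wge0// ltW// geom_gt0.
elim: k => [|k IH]; first by rewrite addn0 !subrr rnorm0.
rewrite addnS -(subrKA (u (n + k)%N)).
apply: le_trans (rnormD _ _) _.
apply: le_trans (lerD (su _) IH) _.
by rewrite (geomS (n + k)); lra.
Qed.

Lemma steps_cvg (V : completeNormedModType R[i]) (u : nat -> V) : steps u ->
  exists l, forall n, rnorm (u n - l) <= geom n *+ 2.
Proof.
move=> su.
have cu : cauchy (u @ \oo).
  apply/cauchy_exP => eps eps0.
  have [e e0 ->] : exists2 e : R, 0 < e & eps = e%:C.
    case: eps eps0 => a b; rewrite ltcE /= => /andP[/eqP -> a0].
    by exists a.
  have [N hN] := geom_smallM 2 e0.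
  exists (u N); exists N => // m /= Nm.
  rewrite -ball_normE /= -rnormE ltcR rnormB.
  by apply: le_lt_trans hN; rewrite mulr_natl steps_dist.
have /cvg_ex [l ul] : cvg (u @ \oo) by exact: cauchy_cvg.
exists l => n.
apply/ler_addgt0Pr => e e0.
have e0' : 0 < e%:C by rewrite ltcR.
have [N _ hN] := (cvgrPdist_le _ _).1 ul _ e0'.
have := hN (maxn n N) (leq_maxr _ _) => /=.
rewrite -rnormE lecR rnormB => h.
rewrite -(subrKA (u (maxn n N))) (le_trans (rnormD _ _))// rnormB.
by rewrite lerD// ?steps_dist// leq_maxl.
Qed.

Lemma steps_complete (V : normedModType R[i]) :
  (forall u : nat -> V, steps u ->
     exists l, exists C, forall n, rnorm (u n - l) <= C * geom n) ->
  forall F : set_system V, ProperFilter F -> cauchy F -> cvg F.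
Proof.
move=> H F FF /cauchyP cF.
have gC n : 0 < (geom n)%:C by rewrite ltcR geom_gt0.
have /choice[u hu] : forall n, exists x, F (ball x (geom n.+2)%:C).
  by move=> n; apply: cF.
have [|l [C hl]] := H u.
  move=> n; have [z []] := filter_ex (filterI (hu n) (hu n.+1)).
  rewrite -!ball_normE /= -!rnormE !ltcR => h1 h2.
  rewrite -(subrKA z) (le_trans (rnormD _ _))//.
  rewrite [rnorm (z - _)]rnormB (geomS n).
  have := geom_gt0 n.+3.
  move: h1 h2; rewrite (geomS n.+1) (geomS n.+2); lra.
apply/cvg_ex; exists l; apply: (@cvgrPdist_le _ _ _ F _ id l).2 => eps eps0.
have [e e0 ->] : exists2 e : R, 0 < e & eps = e%:C.
  case: eps eps0 => a b; rewrite ltcE /= => /andP[/eqP -> a0].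
  by exists a.
have [n hn] := geom_smallM (C + 1) e0.
apply: filterS (hu n) => x; rewrite -ball_normE /= -!rnormE ltcR lecR => hx.
rewrite -(subrKA (u n)) (le_trans (rnormD _ _))// rnormB.
apply: le_trans (ltW hn); rewrite mulrDl mul1r lerD// (le_trans (ltW hx))//.
have := geom_gt0 n.+2; rewrite (geomS n) (geomS n.+1); lra.
Qed.

End geometric_steps.

Section matrix_norm.
Variable R : realType.
Local Notation C := R[i].

Definition l2norm n (v : 'cV[C]_n) : R :=
  Num.sqrt (\sum_i rnorm (v i 0) ^+ 2).

Definition opnorm n (A : 'M[C]_n) : R :=
  sup [set l2norm (A *m v) | v in [set v | l2norm v <= 1]].

Definition mxadj n (A : 'M[C]_n) : 'M[C]_n := map_mx Num.conj A^T.

Section theory.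
Variable n : nat.
Implicit Types (u v w : 'cV[C]_n) (A B : 'M[C]_n).

Lemma l2norm_ge0 v : 0 <= l2norm v.
Proof. exact: sqrtr_ge0. Qed.

Lemma l2normE v : (l2norm v)%:C = sqrtC (dotmx v^T v^T).
Proof.
have -> : dotmx v^T v^T = (\sum_i rnorm (v i 0) ^+ 2)%:C.
  rewrite dotmxE mxE rmorph_sum; apply: eq_bigr => i _.
  by rewrite !mxE rmorphXn /= rnormE normCK.
have s0 : 0 <= \sum_i rnorm (v i 0) ^+ 2 by rewrite sumr_ge0// => i _; rewrite sqr_ge0.
rewrite /l2norm -{2}(sqr_sqrtr s0) rmorphXn /= sqrCK//.
by rewrite lecR sqrtr_ge0.
Qed.

Lemma l2norm_eq0 v : l2norm v = 0 -> v = 0.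
Proof.
move=> h; have := l2normE v; rewrite h => /esym/eqP.
rewrite sqrtC_eq0 dnorm_eq0 => /eqP vT.
by rewrite -[v]trmxK vT trmx0.
Qed.

Lemma l2norm0 : l2norm (0 : 'cV_n) = 0.
Proof.
by rewrite /l2norm big1 ?sqrtr0// => i _; rewrite mxE rnorm0 expr0n.
Qed.

Lemma l2normD u v : l2norm (u + v) <= l2norm u + l2norm v.
Proof.
rewrite -(@lecR R) rmorphD /= !l2normE linearD /=.
by have [] := triangle_lerif (@dotmx _ n) u^T v^T.
Qed.

Lemma l2normZ (c : C) v : l2norm (c *: v) = rnorm c * l2norm v.
Proof.
apply: (@complexI R); rewrite rmorphM /= rnormE !l2normE linearZ /= dnormZ.
by rewrite sqrtCM ?nnegrE ?exprn_ge0 ?dnorm_ge0// sqrCK.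
Qed.

Lemma l2norm_sum (I : Type) (r : seq I) (F : I -> 'cV[C]_n) :
  l2norm (\sum_(i <- r) F i) <= \sum_(i <- r) l2norm (F i).
Proof.
elim/big_ind2: _ => [|x1 x2 y1 y2 h1 h2|//]; first by rewrite l2norm0.
exact: le_trans (l2normD _ _) (lerD h1 h2).
Qed.

Lemma entry_le_l2norm v i : rnorm (v i 0) <= l2norm v.
Proof.
rewrite -(ler_sqr (rnorm_ge0 _) (l2norm_ge0 _)) /l2norm sqr_sqrtr.
  by rewrite (bigD1 i) //= lerDl sumr_ge0// => j _; rewrite sqr_ge0.
by rewrite sumr_ge0// => j _; rewrite sqr_ge0.
Qed.

Lemma l2norm_delta (i : 'I_n) : l2norm (delta_mx i 0 : 'cV[C]_n) = 1.
Proof.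
rewrite /l2norm (bigD1 i) //= mxE !eqxx big1 ?addr0.
  by rewrite /rnorm normr1 expr1n sqrtr1.
by move=> j /negPf ji; rewrite mxE ji rnorm0 expr0n.
Qed.

Lemma mulmx_sumcol A v : A *m v = \sum_j v j 0 *: col j A.
Proof.
apply/colP => i; rewrite mxE summxE; apply: eq_bigr => j _.
by rewrite !mxE mulrC.
Qed.

Lemma l2norm_le_sum v : l2norm v <= \sum_i rnorm (v i 0).
Proof.
have {1}-> : v = \sum_j v j 0 *: delta_mx j 0.
  by rewrite [LHS]matrix_sum_delta; apply: eq_bigr => i _; rewrite big_ord1.
apply: le_trans (l2norm_sum _ _) _; apply: ler_sum => j _.
by rewrite l2normZ l2norm_delta mulr1.
Qed.

Lemma l2norm_mul_bnd A v : l2norm v <= 1 ->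
  l2norm (A *m v) <= \sum_j l2norm (col j A).
Proof.
move=> v1; rewrite mulmx_sumcol; apply: le_trans (l2norm_sum _ _) _.
apply: ler_sum => j _; rewrite l2normZ ler_piMl ?l2norm_ge0//.
exact: le_trans (entry_le_l2norm _ _) v1.
Qed.

Lemma opnorm_has_sup A :
  has_sup [set l2norm (A *m v) | v in [set v | l2norm v <= 1]].
Proof.
split; first by exists (l2norm (A *m 0)), 0 => //=; rewrite l2norm0.
exists (\sum_j l2norm (col j A)) => _ [v v1 <-]; exact: l2norm_mul_bnd.
Qed.

Lemma opnorm_le_ub A (M : R) :
  (forall v, l2norm v <= 1 -> l2norm (A *m v) <= M) -> opnorm A <= M.
Proof.
move=> h; apply: ge_sup; first by case: (opnorm_has_sup A).
by move=> _ [v v1 <-]; apply: h.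
Qed.

Lemma opnorm_ub1 A v : l2norm v <= 1 -> l2norm (A *m v) <= opnorm A.
Proof.
by move=> v1; apply: sup_upper_bound; [exact: opnorm_has_sup|exists v].
Qed.

Lemma opnorm_ge0 A : 0 <= opnorm A.
Proof.
have := @opnorm_ub1 A 0; rewrite mulmx0 l2norm0 ler01; exact.
Qed.

Lemma opnorm_ub A v : l2norm (A *m v) <= opnorm A * l2norm v.
Proof.
have [/eqP|] := eqVneq (l2norm v) 0.
  by move=> /eqP/l2norm_eq0 ->; rewrite mulmx0 l2norm0 mulr0.
move=> v0; have v_gt0 : 0 < l2norm v by rewrite lt0r v0 l2norm_ge0.
have rv : rnorm ((l2norm v)^-1%:C) = (l2norm v)^-1.
  by apply: (@complexI R); rewrite rnormE ger0_norm ?lecR ?invr_ge0 ?l2norm_ge0.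
have := @opnorm_ub1 A ((l2norm v)^-1%:C *: v).
rewrite -scalemxAr !l2normZ rv mulVf// => /(_ (lexx _)).
by rewrite mulrC ler_pdivrMr.
Qed.

Lemma entry_le_opnorm A i j : rnorm (A i j) <= opnorm A.
Proof.
have := @opnorm_ub1 A (delta_mx j 0); rewrite l2norm_delta => /(_ (lexx _)).
rewrite -colE; apply: le_trans; have := entry_le_l2norm (col j A) i.
by rewrite mxE.
Qed.

Lemma opnorm_le_sum A : opnorm A <= \sum_j \sum_i rnorm (A i j).
Proof.
apply: opnorm_le_ub => v v1; apply: le_trans (l2norm_mul_bnd _ v1) _.
apply: ler_sum => j _; apply: le_trans (l2norm_le_sum _) _.
by apply: ler_sum => i _; rewrite mxE.
Qed.

Lemma opnormD A B : opnorm (A + B) <= opnorm A + opnorm B.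
Proof.
apply: opnorm_le_ub => v v1; rewrite mulmxDl.
by apply: le_trans (l2normD _ _) _; rewrite lerD// opnorm_ub1.
Qed.

Lemma opnorm_eq0 A : opnorm A = 0 -> A = 0.
Proof.
move=> h; apply/matrixP => i j; rewrite mxE; apply: rnorm_eq0.
by apply/le_anti; rewrite rnorm_ge0 andbT -h entry_le_opnorm.
Qed.

Lemma opnormZ_le (c : C) A : opnorm (c *: A) <= rnorm c * opnorm A.
Proof.
apply: opnorm_le_ub => v v1; rewrite -scalemxAl l2normZ.
by rewrite ler_wpM2l ?rnorm_ge0 ?opnorm_ub1.
Qed.

Lemma opnormM A B : opnorm (A *m B) <= opnorm A * opnorm B.
Proof.
apply: opnorm_le_ub => v v1; rewrite -mulmxA.
apply: le_trans (opnorm_ub _ _) _.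
by rewrite ler_wpM2l ?opnorm_ge0 ?opnorm_ub1.
Qed.

Lemma opnormZ (c : C) A : opnorm (c *: A) = rnorm c * opnorm A.
Proof.
apply/le_anti; rewrite opnormZ_le /=.
have [->|c0] := eqVneq c 0; first by rewrite rnorm0 mul0r opnorm_ge0.
have rc : rnorm c^-1 = (rnorm c)^-1.
  by apply: (@complexI R); rewrite fmorphV /= !rnormE normfV.
have rc0 : 0 < rnorm c.
  by rewrite lt0r rnorm_ge0 andbT; apply: contra c0 => /eqP/rnorm_eq0 ->.
rewrite -{1}[A](scalerK c0) scalerA -ler_pdivlMl//.
by rewrite -rc (le_trans _ (opnormZ_le _ _))// scalerA.
Qed.

Lemma mxadjK A : mxadj (mxadj A) = A.
Proof. by apply/matrixP => i j; rewrite !mxE conjCK. Qed.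

Lemma mxadjD A B : mxadj (A + B) = mxadj A + mxadj B.
Proof. by apply/matrixP => i j; rewrite !mxE rmorphD. Qed.

Lemma mxadjZ (c : C) A : mxadj (c *: A) = c^* *: mxadj A.
Proof. by apply/matrixP => i j; rewrite !mxE rmorphM. Qed.

Lemma mxadjM A B : mxadj (A *m B) = mxadj B *m mxadj A.
Proof. by rewrite /mxadj trmx_mul map_mxM. Qed.

Lemma dot_adj A v w : dotmx (A *m v)^T w^T = dotmx v^T (mxadj A *m w)^T.
Proof.
rewrite !dotmxE /mxadj; congr (fun_of_matrix _ 0 0).
by rewrite !trmxK map_mxM -map_mx_comp trmx_mul mulmxA; congr (_ *m _ *m _);
   apply/matrixP => i j; rewrite !mxE /= conjCK.
Qed.

Lemma l2norm_sqr_adj A v :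
  l2norm (A *m v) ^+ 2 <= l2norm v * l2norm (mxadj A *m A *m v).
Proof.
have h : 0 <= dotmx (A *m v)^T (A *m v)^T by exact: dnorm_ge0.
rewrite -(@lecR R) rmorphXn rmorphM /= !l2normE sqrtCK -(ger0_norm h).
rewrite dot_adj mulmxA.
by have [] := CauchySchwarz_sqrt (@dotmx _ n) v^T (mxadj A *m A *m v)^T.
Qed.

Lemma opnorm_sqr_le A : opnorm A ^+ 2 <= opnorm (mxadj A *m A).
Proof.
rewrite -[leRHS]sqr_sqrtr ?opnorm_ge0// ler_sqr ?nnegrE ?opnorm_ge0 ?sqrtr_ge0//.
apply: opnorm_le_ub => v v1.
rewrite -[leLHS]ger0_norm ?l2norm_ge0// -sqrtr_sqr ler_sqrt ?opnorm_ge0//.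
apply: le_trans (l2norm_sqr_adj _ _) _.
by rewrite (le_trans (ler_piMl (l2norm_ge0 _) v1))// opnorm_ub1.
Qed.

Lemma opnorm_adj_le A : opnorm A <= opnorm (mxadj A).
Proof.
have [->|] := eqVneq (opnorm A) 0; first exact: opnorm_ge0.
move=> A0; have A_gt0 : 0 < opnorm A by rewrite lt0r A0 opnorm_ge0.
rewrite -(ler_pM2r A_gt0) -expr2.
exact: le_trans (opnorm_sqr_le _) (opnormM _ _).
Qed.

Lemma opnorm_cstar A : opnorm (mxadj A *m A) = opnorm A ^+ 2.
Proof.
apply/le_anti; rewrite opnorm_sqr_le andbT.
apply: le_trans (opnormM _ _) _; rewrite expr2 ler_wpM2r ?opnorm_ge0//.
by rewrite -{2}[A]mxadjK opnorm_adj_le.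
Qed.

End theory.

End matrix_norm.

Definition matalg (R : realType) (n : nat) : Type := 'M[R[i]]_n.

Section matalg_instances.
Variables (R : realType) (n : nat).

HB.instance Definition _ := GRing.Lmodule.copy (matalg R n) 'M[R[i]]_n.

Let opnormC (A : matalg R n) : R[i] := (opnorm A)%:C.

Lemma opnormC_triangle (A B : matalg R n) :
  opnormC (A + B) <= opnormC A + opnormC B.
Proof. by rewrite /opnormC -rmorphD lecR opnormD. Qed.

Lemma opnormC_scale (c : R[i]) (A : matalg R n) :
  opnormC (c *: A) = `|c| * opnormC A.
Proof. by rewrite /opnormC -rnormE -rmorphM opnormZ. Qed.

Lemma opnormC_eq0 (A : matalg R n) : opnormC A = 0 -> A = 0.
Proof. by move=> /complexI /opnorm_eq0. Qed.

HB.instance Definition _ := Lmodule_isNormed.Build R[i] (matalg R n)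
  opnormC_triangle opnormC_scale opnormC_eq0.

Lemma matalg_rnormE (A : matalg R n) : rnorm A = opnorm A.
Proof. by []. Qed.

Lemma real_steps_dist (u : nat -> R) :
  (forall n, `|u n.+1 - u n| <= geom R n) ->
  forall n m, (n <= m)%N -> `|u m - u n| <= geom R n *+ 2.
Proof.
move=> su k m /subnKC <-; set j := (m - k)%N.
apply: (@le_trans _ _ (geom R k *+ 2 - geom R (k + j) *+ 2)); last first.
  by rewrite gerBl mulrn_wge0// ltW// geom_gt0.
elim: j => [|j IH]; first by rewrite addn0 !subrr normr0.
rewrite addnS -(subrKA (u (k + j)%N)).
apply: le_trans (ler_normD _ _) _.
apply: le_trans (lerD (su _) IH) _.
by rewrite (geomS R (k + j)); lra.
Qed.

Lemma real_steps_cvg (u : nat -> R) :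
  (forall n, `|u n.+1 - u n| <= geom R n) ->
  exists l, forall n, `|u n - l| <= geom R n *+ 2.
Proof.
move=> su.
have cu : cauchy (u @ \oo).
  apply/cauchy_exP => e e0.
  have [N hN] := geom_smallM 2 e0.
  exists (u N); exists N => // m /= Nm.
  rewrite -ball_normE /= distrC.
  by apply: le_lt_trans hN; rewrite mulr_natl real_steps_dist.
have /cvg_ex [l ul] : cvg (u @ \oo) by exact: cauchy_cvg.
exists l => k; apply/ler_addgt0Pr => e e0.
have [N _ hN] := (cvgrPdist_le _ _).1 ul _ e0.
have := hN (maxn k N) (leq_maxr _ _) => /=; rewrite distrC => h.
rewrite -(subrKA (u (maxn k N))) (le_trans (ler_normD _ _))// distrC.
by rewrite lerD// ?real_steps_dist// leq_maxl.
Qed.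

Lemma complex_steps_cvg (u : nat -> R[i]) :
  (forall n, rnorm (u n.+1 - u n) <= geom R n) ->
  exists l, forall n, rnorm (u n - l) <= 4 * geom R n.
Proof.
move=> su.
have nRe (z : R[i]) : `|complex.Re z| <= rnorm z.
  by rewrite -(@lecR R) rnormE normc_ge_Re.
have nIm (z : R[i]) : `|complex.Im z| <= rnorm z.
  rewrite -(@lecR R) rnormE normc_def lecR -sqrtr_sqr ler_sqrt ?lerDr ?sqr_ge0//.
  by rewrite addr_ge0 ?sqr_ge0.
have nD (z : R[i]) : rnorm z <= `|complex.Re z| + `|complex.Im z|.
  rewrite -(@lecR R) rnormE normc_def lecR -[leRHS]ger0_norm ?addr_ge0//.
  rewrite -sqrtr_sqr ler_sqrt ?sqr_ge0// sqrrD !real_normK ?num_real//.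
  by rewrite lerD2r lerDl mulrn_wge0// mulr_ge0.
have [a ha] : exists l, forall k, `|complex.Re (u k) - l| <= geom R k *+ 2.
  apply: real_steps_cvg => k; apply: le_trans (su k).
  by rewrite -raddfB nRe.
have [b hb] : exists l, forall k, `|complex.Im (u k) - l| <= geom R k *+ 2.
  apply: real_steps_cvg => k; apply: le_trans (su k).
  by rewrite -raddfB nIm.
exists (a +i* b)%C => k; apply: le_trans (nD _) _.
move: (ha k) (hb k); case: (u k) => x y /= h1 h2.
by apply: le_trans (lerD h1 h2) _; lra.
Qed.

Lemma matalg_complete (F : set_system (matalg R n)) :
  ProperFilter F -> cauchy F -> cvg F.
Proof.
apply: steps_complete => u su.
have H i j : exists l, forall k, rnorm ((u k : 'M_n) i j - l) <= 4 * geom R k.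
  apply: complex_steps_cvg => k; apply: le_trans (su k).
  have := entry_le_opnorm (u k.+1 - u k : 'M_n) i j.
  by rewrite !mxE matalg_rnormE.
exists (\matrix_(i, j) sval (cid (H i j))), (\sum_(j < n) \sum_(i < n) 4) => k.
rewrite matalg_rnormE; apply: le_trans (opnorm_le_sum _) _.
rewrite mulr_suml; apply: ler_sum => j _; rewrite mulr_suml.
apply: ler_sum => i _; rewrite !mxE.
by case: cid => l /= hl.
Qed.

HB.instance Definition _ :=
  Uniform_isComplete.Build (matalg R n) matalg_complete.

Lemma matalg_norm_mul (A B : matalg R n) :
  `|(A *m B : matalg R n)| <= `|A| * `|B|.
Proof. by rewrite -!rnormE -rmorphM lecR !matalg_rnormE opnormM. Qed.

Lemma matalg_norm_cstar (A : matalg R n) :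
  `|(mxadj A *m A : matalg R n)| = `|A| ^+ 2.
Proof. by rewrite -!rnormE -rmorphXn !matalg_rnormE opnorm_cstar. Qed.

HB.instance Definition _ := @isCStarAlgebra.Build R (matalg R n)
  (fun A B => A *m B) (@mxadj R n) (@mulmxA _ _ _ _ _)
  (fun A B D => mulmxDl A B D) (fun A B D => mulmxDr A B D)
  (fun c A B => esym (scalemxAl c A B)) (fun c A B => esym (scalemxAr c A B))
  (@mxadjK R n) (@mxadjD R n) (@mxadjZ R n) (@mxadjM R n)
  matalg_norm_mul matalg_norm_cstar.

End matalg_instances.

Lemma cstar_norm (R : realType) (A : cstarAlgType R) (a : A) :
  rnorm (cstar a) = rnorm a.
Proof.
suff H (b : A) : rnorm b <= rnorm (cstar b).
  by apply/le_anti; rewrite H -{2}[a]cstarK H.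
have [->|b0] := eqVneq (rnorm b) 0; first exact: rnorm_ge0.
have b_gt0 : 0 < rnorm b by rewrite lt0r b0 rnorm_ge0.
rewrite -(ler_pM2r b_gt0) -expr2 -(@lecR R) rmorphXn rmorphM /= !rnormE.
by rewrite -cnorm_cstar cnorm_mul.
Qed.

Lemma cstar_rnormM (R : realType) (A : cstarAlgType R) (a b : A) :
  rnorm (cmul a b) <= rnorm a * rnorm b.
Proof. by rewrite -(@lecR R) rmorphM /= !rnormE cnorm_mul. Qed.

Lemma rnormZ (R : realType) (V : normedModType R[i]) (c : R[i]) (x : V) :
  rnorm (c *: x) = rnorm c * rnorm x.
Proof. by apply: (@complexI R); rewrite rmorphM /= !rnormE normrZ. Qed.

Section bounded_families.
Variables (R : realType) (J : Type) (A : J -> cstarAlgType R).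

Record bfam := BFam {
  bfam_val :> forall j, A j ;
  bfam_bnd : exists M : R, forall j, rnorm (bfam_val j) <= M }.

Lemma bfamP (a b : bfam) : (forall j, a j = b j) -> a = b.
Proof.
case: a b => [a ha] [b hb] /= ab.
have {}ab : a = b by apply: functional_extensionality_dep.
by rewrite -{b}ab in hb *; congr BFam; exact: Prop_irrelevance.
Qed.

HB.instance Definition _ := gen_eqMixin bfam.
HB.instance Definition _ := gen_choiceMixin bfam.

Lemma bfam0_bnd : exists M : R, forall j, rnorm (0 : A j) <= M.
Proof. by exists 0 => j; rewrite rnorm0. Qed.

Lemma bfamN_bnd (a : bfam) : exists M : R, forall j, rnorm (- a j) <= M.
Proof. by have [M hM] := bfam_bnd a; exists M => j; rewrite rnormN. Qed.

Lemma bfamD_bnd (a b : bfam) : exists M : R, forall j, rnorm (a j + b j) <= M.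
Proof.
have [M hM] := bfam_bnd a; have [N hN] := bfam_bnd b.
by exists (M + N) => j; rewrite (le_trans (rnormD _ _))// lerD.
Qed.

Lemma bfamZ_bnd (c : R[i]) (a : bfam) :
  exists M : R, forall j, rnorm (c *: a j) <= M.
Proof.
have [M hM] := bfam_bnd a; exists (rnorm c * M) => j.
by rewrite rnormZ ler_wpM2l ?rnorm_ge0//; exact: hM.
Qed.

Lemma bfamM_bnd (a b : bfam) : exists M : R, forall j, rnorm (cmul (a j) (b j)) <= M.
Proof.
have [M hM] := bfam_bnd a; have [N hN] := bfam_bnd b.
exists (M * N) => j; rewrite (le_trans (cstar_rnormM _ _))//.
by rewrite ler_pM ?rnorm_ge0.
Qed.

Lemma bfamS_bnd (a : bfam) : exists M : R, forall j, rnorm (cstar (a j)) <= M.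
Proof. by have [M hM] := bfam_bnd a; exists M => j; rewrite cstar_norm. Qed.

Definition bfam0 := BFam bfam0_bnd.
Definition bfamN a := BFam (bfamN_bnd a).
Definition bfamD a b := BFam (bfamD_bnd a b).
Definition bfamZ c a := BFam (bfamZ_bnd c a).
Definition bfamM a b := BFam (bfamM_bnd a b).
Definition bfamS a := BFam (bfamS_bnd a).

Lemma bfam_addA : associative bfamD.
Proof. by move=> a b c; apply: bfamP => j /=; rewrite addrA. Qed.

Lemma bfam_addC : commutative bfamD.
Proof. by move=> a b; apply: bfamP => j /=; rewrite addrC. Qed.

Lemma bfam_add0 : left_id bfam0 bfamD.
Proof. by move=> a; apply: bfamP => j /=; rewrite add0r. Qed.

Lemma bfam_addN : left_inverse bfam0 bfamN bfamD.
Proof. by move=> a; apply: bfamP => j /=; rewrite addNr. Qed.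

HB.instance Definition _ := GRing.isZmodule.Build bfam
  bfam_addA bfam_addC bfam_add0 bfam_addN.

Lemma bfam_scaleA (c d : R[i]) (a : bfam) : bfamZ c (bfamZ d a) = bfamZ (c * d) a.
Proof. by apply: bfamP => j /=; rewrite scalerA. Qed.

Lemma bfam_scale1 : left_id 1 bfamZ.
Proof. by move=> a; apply: bfamP => j /=; rewrite scale1r. Qed.

Lemma bfam_scaleDr : right_distributive bfamZ +%R.
Proof. by move=> c a b; apply: bfamP => j /=; rewrite scalerDr. Qed.

Lemma bfam_scaleDl (a : bfam) : {morph bfamZ^~ a : c d / c + d}.
Proof. by move=> c d; apply: bfamP => j /=; rewrite scalerDl. Qed.

HB.instance Definition _ := GRing.Zmodule_isLmodule.Build R[i] bfam
  bfam_scaleA bfam_scale1 bfam_scaleDr bfam_scaleDl.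

Variables (U : set_system J) (UU : UltraFilter U).
Implicit Types a b : bfam.

Lemma ultra_cvg (f : J -> R) (M : R) : (forall j, 0 <= f j <= M) ->
  cvg (f j @[j --> U]).
Proof.
move=> hf.
have FM : (f @ U) `[0, M]%classic.
  by apply: (@filterE _ U) => j /=; rewrite in_itv /= hf.
have [p [_ pU]] := segment_compact (fmap_proper_filter f _) FM.
apply/cvg_ex; exists p => N Np.
have [//|UN] := in_ultra_setVsetC (f @^-1` N) UU.
have [x [xN' xN]] := pU (~` N) N UN Np.
by case: (xN' xN).
Qed.

Definition ulim a : R := lim (rnorm (a j) @[j --> U]).

Lemma ulimP a : rnorm (a j) @[j --> U] --> ulim a.
Proof.
have [M hM] := bfam_bnd a.
have : cvg (rnorm (a j) @[j --> U]).
  by apply: (@ultra_cvg _ M) => j; rewrite rnorm_ge0 hM.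
by [].
Qed.

Arguments ulimP : clear implicits.

Lemma ulim_uniq a (l : R) : rnorm (a j) @[j --> U] --> l -> ulim a = l.
Proof. by move=> h; apply: cvg_lim. Qed.

Lemma ultra_le (f g : J -> R) (l l' : R) :
  f j @[j --> U] --> l -> g j @[j --> U] --> l' ->
  (forall j, f j <= g j) -> l <= l'.
Proof.
move=> fl gl fg; rewrite -subr_le0.
apply: cvgr_to_le (cvgB fl gl) _.
by apply: (@filterE _ U) => j /=; rewrite subr_le0.
Qed.

Lemma ulim_ge0 a : 0 <= ulim a.
Proof. by apply: ultra_le (@cvg_cst R 0 J U _) (ulimP a) _ => j; rewrite rnorm_ge0. Qed.

Lemma ulim_le a (M : R) : (forall j, rnorm (a j) <= M) -> ulim a <= M.
Proof. by move=> h; apply: ultra_le (ulimP a) (@cvg_cst R M J U _) h. Qed.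

Lemma ulim0 : ulim 0 = 0.
Proof.
apply/le_anti; rewrite ulim_ge0 andbT; apply: ulim_le => j.
by rewrite [(0 : bfam) j]/(0 : A j) rnorm0.
Qed.

Lemma ulimN a : ulim (- a) = ulim a.
Proof.
apply: ulim_uniq; rewrite (_ : (fun j => _) = (fun j => rnorm (a j))).
  exact: ulimP.
by apply: funext => j; rewrite [(- a) j]/(- a j) rnormN.
Qed.

Lemma ulimD a b : ulim (a + b) <= ulim a + ulim b.
Proof.
apply: ultra_le (ulimP _) (cvgD (ulimP a) (ulimP b)) _ => j.
exact: rnormD.
Qed.

Lemma ulim_eq a (f : J -> R) (l : R) :
  f j @[j --> U] --> l -> (forall j, rnorm (a j) = f j) -> ulim a = l.
Proof. by move=> fl /funext af; apply: ulim_uniq; rewrite af. Qed.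

Lemma ulimZ (c : R[i]) a : ulim (c *: a) = rnorm c * ulim a.
Proof.
apply: ulim_eq (cvgM (@cvg_cst R (rnorm c) J U _) (ulimP a)) _ => j /=.
exact: rnormZ.
Qed.

Lemma ulimM a b : ulim (bfamM a b) <= ulim a * ulim b.
Proof.
apply: ultra_le (ulimP _) (cvgM (ulimP a) (ulimP b)) _ => j.
exact: cstar_rnormM.
Qed.

Lemma ulimS a : ulim (bfamS a) = ulim a.
Proof.
apply: ulim_uniq; rewrite (_ : (fun j => _) = (fun j => rnorm (a j))).
  exact: ulimP.
by apply: funext => j /=; rewrite cstar_norm.
Qed.

Lemma ulim_cstar a : ulim (bfamM (bfamS a) a) = ulim a ^+ 2.
Proof.
rewrite expr2; apply: ulim_eq (cvgM (ulimP a) (ulimP a)) _ => j /=.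
apply: (@complexI R).
by rewrite rnormE cnorm_cstar -rnormE -rmorphXn expr2.
Qed.

Definition nullfam : {pred bfam} :=
  fun a => `[< rnorm (a j) @[j --> U] --> (0 : R) >].

Lemma nullfamP a : (a \in nullfam) = (ulim a == 0).
Proof.
apply/asboolP/eqP; first exact: ulim_uniq.
by move=> a0; have := ulimP a; rewrite a0.
Qed.

Lemma nullfam_zmod : zmod_closed nullfam.
Proof.
split=> [|a b]; rewrite !nullfamP ?ulim0// => /eqP a0 /eqP b0.
rewrite eq_le ulim_ge0 andbT; apply: le_trans (ulimD _ _) _.
by rewrite ulimN a0 b0 addr0.
Qed.

HB.instance Definition _ := GRing.isZmodClosed.Build bfam nullfam nullfam_zmod.

Definition ultraprod : Type := Quotient.quot nullfam.

HB.instance Definition _ := GRing.Zmodule.copy ultraprod (Quotient.quot nullfam).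

Definition upi (a : bfam) : ultraprod := (\pi_(Quotient.quot nullfam) a)%qT.

Definition urepr (x : ultraprod) : bfam := repr (x : Quotient.quot nullfam).

Lemma ureprK x : upi (urepr x) = x.
Proof. exact: (@reprK _ (Quotient.quot nullfam)). Qed.

Lemma upi_eq a b : upi a = upi b <-> ulim (a - b) = 0.
Proof.
split=> [/eqP|] h; last (apply/eqP; move/eqP: h).
  by apply/eqP; move: h; rewrite /upi -Quotient.idealrBE nullfamP.
by rewrite /upi -Quotient.idealrBE nullfamP.
Qed.

Lemma upiD a b : upi (a + b) = upi a + upi b.
Proof. exact: (@Quotient.pi_add _ nullfam). Qed.

Lemma upiN a : upi (- a) = - upi a.
Proof. exact: (@Quotient.pi_opp _ nullfam). Qed.

Lemma upiB a b : upi (a - b) = upi a - upi b.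
Proof. by rewrite upiD upiN. Qed.

Lemma ulim_urepr a : ulim (urepr (upi a)) = ulim a.
Proof.
have /upi_eq h : upi (urepr (upi a)) = upi a by rewrite ureprK.
have h' : ulim (a - urepr (upi a)) = 0 by rewrite -ulimN opprB.
apply/le_anti/andP; split.
  by rewrite -{1}(subrK a (urepr _)) (le_trans (ulimD _ _))// h add0r.
by rewrite -{1}(subrK (urepr (upi a)) a) (le_trans (ulimD _ _))// h' add0r.
Qed.

Definition uscale (c : R[i]) (x : ultraprod) : ultraprod := upi (c *: urepr x).
Definition umul (x y : ultraprod) : ultraprod :=
  upi (bfamM (urepr x) (urepr y)).
Definition ustar (x : ultraprod) : ultraprod := upi (bfamS (urepr x)).
Definition unorm (x : ultraprod) : R[i] := (ulim (urepr x))%:C.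

Lemma upi0_le a : ulim a <= 0 -> ulim a = 0.
Proof. by move=> h; apply/le_anti; rewrite h ulim_ge0. Qed.

Lemma upi_repr a : ulim (urepr (upi a) - a) = 0.
Proof. by apply/upi_eq; rewrite ureprK. Qed.

Lemma upiZ c a : upi (c *: a) = uscale c (upi a).
Proof.
apply/esym/upi_eq.
by rewrite -scalerBr ulimZ upi_repr mulr0.
Qed.

Lemma cstarN (B : cstarAlgType R) (x : B) : cstar (- x) = - cstar x.
Proof. by rewrite -scaleN1r cstarZ rmorphN1 scaleN1r. Qed.

Lemma bfamDE a b j : (a + b) j = a j + b j. Proof. by []. Qed.

Lemma bfamNE a j : (- a) j = - a j. Proof. by []. Qed.

Lemma bfamSE a j : bfamS a j = cstar (a j). Proof. by []. Qed.

Lemma bfamME a b j : bfamM a b j = cmul (a j) (b j). Proof. by []. Qed.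

Definition bfamE := (bfamDE, bfamNE, bfamSE, bfamME).

Lemma upiS a : upi (bfamS a) = ustar (upi a).
Proof.
apply/esym/upi_eq; rewrite -[RHS](upi_repr a) -[RHS]ulimS; congr ulim.
by apply: bfamP => j; rewrite !bfamE cstarD cstarN.
Qed.

Lemma cmulN (B : cstarAlgType R) (x y : B) : cmul x (- y) = - cmul x y.
Proof. by rewrite -scaleN1r cmulZr scaleN1r. Qed.

Lemma cmulNl (B : cstarAlgType R) (x y : B) : cmul (- x) y = - cmul x y.
Proof. by rewrite -scaleN1r cmulZl scaleN1r. Qed.

Lemma upiM a b : upi (bfamM a b) = umul (upi a) (upi b).
Proof.
apply/esym/upi_eq; set a' := urepr _; set b' := urepr _.
have -> : bfamM a' b' - bfamM a b = bfamM (a' - a) b' + bfamM a (b' - b).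
  apply: bfamP => j; rewrite !bfamE.
  by rewrite cmulDl cmulDr cmulN cmulNl addrA subrK.
apply: upi0_le; apply: le_trans (ulimD _ _) _.
apply: le_trans (lerD (ulimM _ _) (ulimM _ _)) _.
by rewrite !upi_repr mul0r mulr0 addr0.
Qed.

Lemma uscaleA c d (x : ultraprod) : uscale c (uscale d x) = uscale (c * d) x.
Proof. by rewrite -[x]ureprK -!upiZ scalerA. Qed.

Lemma uscale1 : left_id 1 uscale.
Proof. by move=> x; rewrite -[x]ureprK -!upiZ scale1r. Qed.

Lemma uscaleDr : right_distributive uscale +%R.
Proof.
by move=> c x y; rewrite -[x]ureprK -[y]ureprK -upiD -!upiZ scalerDr upiD.
Qed.

Lemma uscaleDl (x : ultraprod) : {morph uscale^~ x : c d / c + d}.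
Proof.
by move=> c d; rewrite -[x]ureprK -!upiZ scalerDl upiD.
Qed.

HB.instance Definition _ := GRing.Zmodule_isLmodule.Build R[i] ultraprod
  uscaleA uscale1 uscaleDr uscaleDl.

Lemma upi_scale c a : c *: upi a = upi (c *: a).
Proof. by rewrite upiZ. Qed.

Lemma unorm_triangle (x y : ultraprod) : unorm (x + y) <= unorm x + unorm y.
Proof.
rewrite -[x]ureprK -[y]ureprK -upiD /unorm !ulim_urepr -rmorphD lecR.
exact: ulimD.
Qed.

Lemma unorm_scale (c : R[i]) (x : ultraprod) : unorm (c *: x) = `|c| * unorm x.
Proof.
rewrite -[x]ureprK upi_scale /unorm !ulim_urepr ulimZ.
by rewrite rmorphM /= rnormE.
Qed.

Lemma unorm_eq0 (x : ultraprod) : unorm x = 0 -> x = 0.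
Proof.
move=> /complexI x0; rewrite -[x]ureprK -[RHS]ureprK; apply/upi_eq.
apply: upi0_le; apply: le_trans (ulimD _ _) _; rewrite x0 ulimN add0r.
have -> : (0 : ultraprod) = upi 0 by rewrite -(subrr (0 : bfam)) upiB subrr.
by rewrite ulim_urepr ulim0.
Qed.

HB.instance Definition _ := Lmodule_isNormed.Build R[i] ultraprod
  unorm_triangle unorm_scale unorm_eq0.

Lemma rnorm_upi a : rnorm (upi a) = ulim a.
Proof. by rewrite -ulim_urepr. Qed.

Lemma upi_small (x : ultraprod) (e : R) : 0 < e ->
  exists2 a : bfam, upi a = x & forall j, rnorm (a j) <= rnorm x + e.
Proof.
move=> e0; pose a := urepr x.
have xe : 0 <= rnorm x + e by rewrite addr_ge0 ?rnorm_ge0// ltW.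
pose f j : A j := if rnorm (a j) <= rnorm x + e then a j else 0.
have fle j : rnorm (f j) <= rnorm x + e.
  by rewrite /f; case: ifP => // _; rewrite rnorm0.
have fbnd : exists M : R, forall j, rnorm (f j) <= M by exists (rnorm x + e).
exists (BFam fbnd) => //; rewrite -[x]ureprK; apply/upi_eq.
apply: ulim_uniq; apply/cvgrPdist_le => /= d d0.
have H : U [set j | `|ulim a - rnorm (a j)| <= e].
  by have [h _] := @cvgrPdist_le R R J U _ (fun j => rnorm (a j)) (ulim a); apply: h (ulimP a) _ e0.
apply: filterS H => j /=.
rewrite distrC => /(le_trans (ler_norm _)); rewrite lerBlDl => aj.
by rewrite /= /f aj subrr rnorm0 subrr normr0 ltW.
Qed.

Lemma ultraprod_complete (F : set_system ultraprod) :
  ProperFilter F -> cauchy F -> cvg F.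
Proof.
apply: steps_complete => u su.
have /boolp.choice[d hd] k : exists a : bfam,
    upi a = u k.+1 - u k /\ forall j, rnorm (a j) <= geom R k *+ 2.
  have [a ax ha] := upi_small (u k.+1 - u k) (geom_gt0 R k).
  by exists a; split=> // j; rewrite (le_trans (ha j))// mulr2n lerD2r su.
pose v := fix v k : bfam := if k is k'.+1 then v k' + d k'.+1 else urepr (u 1%N).
have vu k : upi (v k) = u k.+1.
  elim: k => [|k IH]; first exact: ureprK.
  by rewrite [v _]/(v k + d k.+1) upiD IH (hd k.+1).1 addrC subrK.
have hl j : exists l, forall k, rnorm (v k j - l) <= geom R k *+ 2.
  apply: (@steps_cvg R (A j) (fun k => v k j)) => k.
  rewrite [v k.+1]/(v k + d k.+1) bfamDE addrC addKr geomS.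
  exact: (hd k.+1).2.
pose l j := sval (cid (hl j)).
have lv j k : rnorm (v k j - l j) <= geom R k *+ 2 by rewrite /l; case: cid.
have lbnd : exists M : R, forall j, rnorm (l j) <= M.
  have [M hM] := bfam_bnd (v 0%N); exists (M + geom R 0 *+ 2) => j.
  rewrite -[l j](subrK (v 0%N j)) addrC (le_trans (rnormD _ _))// lerD//.
  by rewrite rnormB.
exists (upi (BFam lbnd)), 3 => k.
rewrite -(subrKA (u k.+1)) (le_trans (rnormD _ _))// rnormB.
have := su k; have : rnorm (u k.+1 - upi (BFam lbnd)) <= geom R k *+ 2.
  rewrite -vu -upiB rnorm_upi; apply: ulim_le => j.
  by rewrite !bfamE; exact: lv.
lra.
Qed.

HB.instance Definition _ :=
  Uniform_isComplete.Build ultraprod ultraprod_complete.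

Lemma umulA : associative umul.
Proof.
move=> x y z; rewrite -[x]ureprK -[y]ureprK -[z]ureprK -!upiM; congr upi.
by apply: bfamP => j; rewrite !bfamE cmulA.
Qed.

Lemma umulDl : left_distributive umul +%R.
Proof.
move=> x y z; rewrite -[x]ureprK -[y]ureprK -[z]ureprK -!(upiM, upiD).
by congr upi; apply: bfamP => j; rewrite !bfamE cmulDl.
Qed.

Lemma umulDr : right_distributive umul +%R.
Proof.
move=> x y z; rewrite -[x]ureprK -[y]ureprK -[z]ureprK -!(upiM, upiD).
by congr upi; apply: bfamP => j; rewrite !bfamE cmulDr.
Qed.

Lemma umulZl (c : R[i]) x y : umul (c *: x) y = c *: umul x y.
Proof.
rewrite -(ureprK x) -(ureprK y); move: (urepr x) (urepr y) => a b.
rewrite upi_scale -!upiM upi_scale.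
by congr upi; apply: bfamP => j; rewrite !bfamE [LHS]cmulZl.
Qed.

Lemma umulZr (c : R[i]) x y : umul x (c *: y) = c *: umul x y.
Proof.
rewrite -(ureprK x) -(ureprK y); move: (urepr x) (urepr y) => a b.
rewrite upi_scale -!upiM upi_scale.
by congr upi; apply: bfamP => j; rewrite !bfamE [LHS]cmulZr.
Qed.

Lemma ustarK : involutive ustar.
Proof.
move=> x; rewrite -[x]ureprK -!upiS.
by congr upi; apply: bfamP => j; rewrite !bfamE cstarK.
Qed.

Lemma ustarD : {morph ustar : x y / x + y}.
Proof.
move=> x y; rewrite -[x]ureprK -[y]ureprK -!(upiS, upiD).
by congr upi; apply: bfamP => j; rewrite !bfamE cstarD.
Qed.

Lemma ustarZ (c : R[i]) x : ustar (c *: x) = c^* *: ustar x.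
Proof.
rewrite -(ureprK x); move: (urepr x) => a.
rewrite upi_scale -!upiS upi_scale.
by congr upi; apply: bfamP => j; rewrite !bfamE [LHS]cstarZ.
Qed.

Lemma ustarM x y : ustar (umul x y) = umul (ustar y) (ustar x).
Proof.
rewrite -(ureprK x) -(ureprK y); move: (urepr x) (urepr y) => a b.
rewrite -upiM -!upiS -upiM.
by congr upi; apply: bfamP => j; rewrite !bfamE cstarM.
Qed.

Lemma unorm_mul x y : `|umul x y| <= `|x| * `|y|.
Proof.
rewrite -[x]ureprK -[y]ureprK -upiM -!rnormE -rmorphM lecR !rnorm_upi.
exact: ulimM.
Qed.

Lemma unorm_cstar x : `|umul (ustar x) x| = `|x| ^+ 2.
Proof.
rewrite -[x]ureprK -upiS -upiM -!rnormE -rmorphXn !rnorm_upi.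
by rewrite ulim_cstar.
Qed.

HB.instance Definition _ := @isCStarAlgebra.Build R ultraprod umul ustar
  umulA umulDl umulDr umulZl umulZr ustarK ustarD ustarZ ustarM
  unorm_mul unorm_cstar.

End bounded_families.

(** *-polynomials in the noncommuting variables x_0, x_1, ... and their adjoints,
    without constant term since the algebras need not have a unit. *)
Inductive starpoly (R : realType) : Type :=
| PVar of nat
| PAdd of starpoly R & starpoly R
| PScale of R[i] & starpoly R
| PMul of starpoly R & starpoly R
| PStar of starpoly R.

Fixpoint pvar_in (R : realType) (x : nat) (P : starpoly R) : bool :=
  match P with
  | PVar y => x == y
  | PAdd P Q | PMul P Q => pvar_in x P || pvar_in x Q
  | PScale _ P | PStar P => pvar_in x P
  end.

Fixpoint peval (R : realType) (A : cstarAlgType R) (e : nat -> A)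
    (P : starpoly R) : A :=
  match P with
  | PVar x => e x
  | PAdd P Q => peval e P + peval e Q
  | PScale c P => c *: peval e P
  | PMul P Q => cmul (peval e P) (peval e Q)
  | PStar P => cstar (peval e P)
  end.

Inductive formula (R : realType) : Type :=
| FNorm of starpoly R
| FConn (k : nat) (u : 'rV[R]_k -> R) of continuous u & ('I_k -> formula R)
| FSup of nat & formula R
| FInf of nat & formula R.

Fixpoint free_in (R : realType) (x : nat) (phi : formula R) : Prop :=
  match phi with
  | FNorm P => pvar_in x P
  | FConn _ _ _ f => exists i, free_in x (f i)
  | FSup y psi | FInf y psi => x <> y /\ free_in x psi
  end.

Definition sentence (R : realType) (phi : formula R) : Prop :=
  forall x, ~ free_in x phi.

Definition unit_ball (R : realType) (A : cstarAlgType R) : set A :=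
  [set a | rnorm a <= 1].
Arguments unit_ball {R} A.

Definition update (T : Type) (e : nat -> T) (x : nat) (a : T) : nat -> T :=
  fun y => if y == x then a else e y.

(** The real [sup] and [inf] are 0 on unbounded sets, but for valuations in the
    unit ball the values of a formula are bounded by a constant. *)
Fixpoint feval (R : realType) (A : cstarAlgType R) (phi : formula R)
    (e : nat -> A) : R :=
  match phi with
  | FNorm P => rnorm (peval e P)
  | FConn _ u _ f => u (\row_i feval (f i) e)
  | FSup x psi => sup [set feval psi (update e x a) | a in unit_ball A]
  | FInf x psi => inf [set feval psi (update e x a) | a in unit_ball A]
  end.

(** The value of a sentence does not depend on the valuation. *)
Definition value (R : realType) (A : cstarAlgType R) (phi : formula R) : R :=
  feval phi (fun=> 0 : A).
Arguments value {R} A phi.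

Definition elem_equiv (R : realType) (A B : cstarAlgType R) : Prop :=
  forall phi : formula R, sentence phi -> value A phi = value B phi.

Definition pseudomatricial (R : realType) (A : cstarAlgType R) : Prop :=
  exists (J : Type) (U : set_system J) (UU : UltraFilter U) (n : J -> nat),
    (forall j, (0 < n j)%N) /\
    elem_equiv A (ultraprod (fun j => matalg R (n j) : cstarAlgType R) UU).

Section cstar_notions.
Variables (R : realType) (A : cstarAlgType R).

Definition finite_dimensional : Prop :=
  exists (n : nat) (v : 'I_n -> A),
    forall a, exists c : 'I_n -> R[i], a = \sum_i c i *: v i.

Definition projection (p : A) : Prop := cstar p = p /\ cmul p p = p.

Definition subprojection (q p : A) : Prop := projection q /\ cmul p q = q.

Definition minimal_projection (p : A) : Prop :=
  [/\ projection p, p <> 0 & forall q, subprojection q p -> q = 0 \/ q = p].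

(** The middle condition says that [tr] has norm 1; it implies that [tr] is
    bounded, as [sup] is 0 on unbounded sets. *)
Definition tracial_state (tr : {scalar A}) : Prop :=
  [/\ forall a, 0 <= tr (cmul (cstar a) a),
      sup [set rnorm (tr a) | a in unit_ball A] = 1
    & forall a b, tr (cmul a b) = tr (cmul b a)].

Definition faithful (tr : {scalar A}) : Prop :=
  forall a, tr (cmul (cstar a) a) = 0 -> a = 0.

Definition closed_ideal (I : set A) : Prop :=
  [/\ closed I, I 0, forall a b, I a -> I b -> I (a + b),
      forall c a, I a -> I (c *: a)
    & forall a b, I a -> I (cmul a b) /\ I (cmul b a)].

Definition simple_cstar : Prop :=
  forall I : set A, closed_ideal I -> I = [set 0] \/ I = setT.

End cstar_notions.

Arguments finite_dimensional {R} A.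
Arguments simple_cstar {R} A.

(* Main.v *)
From HB Require Import structures.
Require Import Defs.
From mathcomp Require Import all_boot all_order all_algebra.
From mathcomp Require Import complex.
From mathcomp Require Import all_classical all_reals.
From mathcomp Require Import topology normedtype.
From mathcomp Require Import ring lra.

(** A pseudomatricial algebra [A] shares the values of all sentences with an
    ultraproduct of matrix algebras, and by the theorem of Los ([los]) these are
    limits of values in the factors.  If [A] has infinite dimension, the sizes of
    the matrices tend to infinity ([pseudomatricial_limit]): in infinite dimension
    the unit ball contains arbitrarily many points at mutual distance 1/2, which
    is impossible in matrix algebras of bounded size.  So [A] inherits, up to
    arbitrarily small errors, everything that sentences say about all large matrix
    algebras.

    A minimal projection of a large matrix algebra has rank one and therefore has
    many orthogonal copies, so its normalized trace is small.  The sentence that is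
    transferred to [A] says that every projection vanishes, has a proper
    subprojection, or has [N] orthogonal copies ([matrix_projection_cases],
    [matalg_copies]); for a minimal projection [p] of [A] only the last alternative
    is possible ([minimal_no_cut]).  A tracial state takes the same value at all the
    copies, and a bounded value at their sum, whence [tr p] is of the order of
    [1 / N] for every [N] ([trace_of_copies], [minimal_trace0]).  In both directions
    approximate projections are replaced by nearby projections
    ([projection_near]).

    In the same way [A] has a unit ([unit_exists]) and a minimal projection
    ([minimal_projection_exists]); minimality is first expressed by a condition that
    survives approximation, the multiplicativity of the norm on the corner.  A
    tracial state exists ([tracial_state_exists]) because finitely many elements of
    [A] can be realized in a matrix algebra with their *-algebraic relations
    preserved approximately ([finitely_representable]); it is an ultralimit of
    normalized matrix traces.  It vanishes at the minimal projection [p], so it is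
    not faithful, and its ideal ([trace_ideal]) is closed, contains [p], and is
    proper, so [A] is not simple. *)

Set Implicit Arguments.
Unset Strict Implicit.
Unset Printing Implicit Defensive.

Import Order.TTheory GRing.Theory Num.Theory.
Import numFieldNormedType.Exports.

Local Open Scope classical_set_scope.
Local Open Scope complex_scope.
Local Open Scope ring_scope.

Local Notation "a ** b" := (cmul a b) (at level 40, left associativity).

(** * Norms and projections in C*-algebras *)

Section cstar_algebra.
Variables (R : realType) (A : cstarAlgType R).
Implicit Types (a b c p q x y : A).

Lemma cmul0r a : 0 ** a = 0.
Proof. by apply: (addrI (0 ** a)); rewrite -cmulDl !addr0. Qed.

Lemma cmulr0 a : a ** 0 = 0.
Proof. by apply: (addrI (a ** 0)); rewrite -cmulDr !addr0. Qed.

Lemma cmulBl a b c : (a - b) ** c = a ** c - b ** c.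
Proof. by rewrite cmulDl cmulNl. Qed.

Lemma cmulBr a b c : a ** (b - c) = a ** b - a ** c.
Proof. by rewrite cmulDr cmulN. Qed.

Lemma cstarB a b : cstar (a - b) = cstar a - cstar b.
Proof. by rewrite cstarD cstarN. Qed.

Lemma cstar0 : cstar (0 : A) = 0.
Proof. by apply: (addrI (cstar 0)); rewrite -cstarD !addr0. Qed.

Lemma cstar_sum (I : Type) (r : seq I) (F : I -> A) :
  cstar (\sum_(i <- r) F i) = \sum_(i <- r) cstar (F i).
Proof. exact: (big_morph _ (@cstarD _ A) cstar0). Qed.

Lemma cmul_suml (I : Type) (r : seq I) (F : I -> A) x :
  (\sum_(i <- r) F i) ** x = \sum_(i <- r) F i ** x.
Proof. exact: (big_morph (cmul^~ x) (fun a b => cmulDl a b x) (cmul0r x)). Qed.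

Lemma cmul_sumr (I : Type) (r : seq I) (F : I -> A) x :
  x ** (\sum_(i <- r) F i) = \sum_(i <- r) x ** F i.
Proof. exact: (big_morph (cmul x) (cmulDr x) (cmulr0 x)). Qed.

Lemma rnorm_sum (V : normedZmodType R[i]) (I : Type) (r : seq I) (F : I -> V) :
  rnorm (\sum_(i <- r) F i) <= \sum_(i <- r) rnorm (F i).
Proof.
elim/big_ind2: _ => [|x1 x2 y1 y2 h1 h2|//]; first by rewrite rnorm0.
exact: le_trans (rnormD _ _) (lerD h1 h2).
Qed.

Lemma rnorm_real (r : R) : 0 <= r -> rnorm (r%:C : R[i]) = r.
Proof. by move=> r0; apply: (@complexI R); rewrite rnormE ger0_norm ?lecR. Qed.

Lemma rnormCM (c z : R[i]) : rnorm (c * z) = rnorm c * rnorm z.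
Proof. by apply: (@complexI R); rewrite rmorphM /= !rnormE normrM. Qed.

Lemma rnorm_gt0 (V : normedZmodType R[i]) (x : V) : x != 0 -> 0 < rnorm x.
Proof.
by move=> x0; rewrite lt0r rnorm_ge0 andbT; apply: contra x0 => /eqP/rnorm_eq0 ->.
Qed.

Lemma rnorm_normalize (V : normedModType R[i]) (x : V) : x != 0 ->
  rnorm ((rnorm x)^-1%:C *: x) = 1.
Proof.
move=> /rnorm_gt0 x0.
by rewrite rnormZ rnorm_real ?invr_ge0 ?rnorm_ge0// mulVf ?gt_eqF.
Qed.

Lemma rnormB_le (V : normedZmodType R[i]) (x y : V) :
  rnorm (x - y) <= rnorm x + rnorm y.
Proof. by rewrite -[rnorm y]rnormN rnormD. Qed.

Lemma rnorm_dist (V : normedZmodType R[i]) (x y : V) :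
  rnorm x <= rnorm y + rnorm (x - y).
Proof. by rewrite -{1}(subrK y x) addrC rnormD. Qed.

Lemma rnormM_le1 a b : rnorm a <= 1 -> rnorm (a ** b) <= rnorm b.
Proof.
by move=> a1; rewrite (le_trans (cstar_rnormM _ _))// ler_piMl ?rnorm_ge0.
Qed.

Lemma rnormM_le1r a b : rnorm b <= 1 -> rnorm (a ** b) <= rnorm a.
Proof.
by move=> b1; rewrite (le_trans (cstar_rnormM _ _))// ler_piMr ?rnorm_ge0.
Qed.

Lemma rnormM_ball a b : rnorm a <= 1 -> rnorm b <= 1 -> rnorm (a ** b) <= 1.
Proof. by move=> a1 b1; rewrite (le_trans (rnormM_le1 _ a1)). Qed.

Lemma rnorm_cstarM a : rnorm (cstar a ** a) = rnorm a ^+ 2.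
Proof. by apply: (@complexI R); rewrite rmorphXn /= !rnormE cnorm_cstar. Qed.

Lemma rnorm_sa_sqr a : cstar a = a -> rnorm (a ** a) = rnorm a ^+ 2.
Proof. by move=> sa; rewrite -{1}sa rnorm_cstarM. Qed.

Lemma cstar_cstarM a : cstar (cstar a ** a) = cstar a ** a.
Proof. by rewrite cstarM cstarK. Qed.

(** The C*-identity gives [rnorm a ^+ 2 <= rnorm a + d] for self-adjoint [a]. *)
Lemma rnorm_approx_projection a (d : R) : 0 <= d ->
  cstar a = a -> rnorm (a ** a - a) <= d -> rnorm a <= 1 + d.
Proof.
move=> d0 sa h; have := rnorm_dist (a ** a) a; rewrite rnorm_sa_sqr// expr2.
have := rnorm_ge0 a; nra.
Qed.

Lemma projection_norm p : projection p -> p <> 0 -> rnorm p = 1.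
Proof.
move=> [sp pp] p0; have := rnorm_sa_sqr sp; rewrite pp => /eqP.
have p0' : rnorm p != 0 by apply/eqP => /rnorm_eq0.
by rewrite expr2 -{1}[rnorm p]mulr1 (inj_eq (mulfI p0')) => /eqP.
Qed.

Lemma projection_ball p : projection p -> rnorm p <= 1.
Proof.
move=> pp; have [->|/eqP p0] := eqVneq p 0; first by rewrite rnorm0.
by rewrite projection_norm.
Qed.

Lemma subprojectionB p q : projection p -> subprojection q p ->
  cmul q p = q /\ projection (p - q).
Proof.
move=> [sp pp] [[sq qq] pq].
have qp : q ** p = q by have := congr1 cstar pq; rewrite cstarM sp sq.
split=> //; split; first by rewrite cstarB sp sq.
by rewrite cmulBl !cmulBr pp pq qp qq subrr subr0.
Qed.

Lemma le_geom_eps (s t C : R) : (forall n, s <= t + C * geom R n) -> s <= t.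
Proof.
move=> H; apply/ler_addgt0Pr => e e0; have [n hn] := geom_smallM C e0.
by apply: le_trans (H n) _; rewrite lerD2l ltW.
Qed.

Lemma rnorm_geom_eq0 (V : normedZmodType R[i]) (a : V) (C : R) :
  (forall n, rnorm a <= C * geom R n) -> a = 0.
Proof.
move=> H; apply: rnorm_eq0; apply/le_anti; rewrite rnorm_ge0 andbT.
by apply: (@le_geom_eps _ _ C) => n; rewrite add0r.
Qed.

End cstar_algebra.

(** * Stability of projections

    An approximate projection is corrected by the iteration
    [a |-> 3 a^2 - 2 a^3], whose fixed points 0 and 1 are attracting.  As it
    only uses polynomials without constant term and completeness, it works in
    algebras without a unit and needs no functional calculus. *)

Section projection_stability.
Variables (R : realType) (A : cstarAlgType R).
Implicit Types (a p : A).

Definition idem_defect a : A := a ** a - a.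

(** With [h = a^2 - a] this is [3 a^2 - 2 a^3]; the form below makes the change
    [newton a - a] visibly of the order of the defect. *)
Definition newton a : A := a + idem_defect a - a ** idem_defect a *+ 2.

(** The convergence is quadratic: the new defect is [4 h^3 - 3 h^2].  Since [a]
    and [h] commute and [a^2 = a + h], every product that occurs reduces to a
    combination of [a], [h], [a h], [h^2], [a h^2] and [h^3]. *)
Lemma newton_defect a (h := idem_defect a) :
  idem_defect (newton a) = (h ** h ** h) *+ 4 - (h ** h) *+ 3.
Proof.
have aa : a ** a = a + h by rewrite /h /idem_defect addrC subrK.
have ha : h ** a = a ** h by rewrite /h /idem_defect cmulBl cmulBr cmulA.
rewrite [in LHS]/idem_defect /newton -/h; move: h aa ha => h aa ha.
set w := a ** h; set k := h ** h; set l := k ** h.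
pose m := a ** k.
have aw : a ** w = w + k by rewrite /w cmulA aa cmulDl.
have wa : w ** a = w + k by rewrite /w -cmulA ha aw.
have hw : h ** w = m by rewrite /w cmulA ha -cmulA.
have wh : w ** h = m by rewrite /w -cmulA.
have ba : (a + h - w *+ 2) ** a = a + h - w - k *+ 2.
  rewrite cmulBl mulr2n !cmulDl aa ha wa -mulr2n mulrnDl opprD mulr2n opprD.
  by rewrite !addrA addrK.
have bh : (a + h - w *+ 2) ** h = w + k - m *+ 2.
  by rewrite cmulBl mulr2n !cmulDl wh.
have bw : (a + h - w *+ 2) ** w = w + k - m - l *+ 2.
  rewrite {2}/w cmulA ba !cmulBl cmulDl wh mulr2n cmulDl -/l.
  by rewrite -mulr2n.
apply/eqP; rewrite subr_eq cmulBr cmulDr ba bh mulr2n cmulDr bw.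
rewrite -[X in _ - X]mulr2n !mulrnBl mulrnDl -mulrnA !opprB !opprD !addrA.
(* The first eight terms cancel in pairs. *)
rewrite [X in X == _](ACl (3*6*5*7*8*14*9*15*10*11*12*13*4*18*19*1*2*16*17)) /=.
by rewrite !(addNr, add0r) [X in _ == X - _ - _ - _ + _ + _ - _ - _]mulrSr mulrSr mulr2n.
Qed.

Lemma newton_dist a : newton a - a = idem_defect a - a ** idem_defect a *+ 2.
Proof. by rewrite /newton addrAC [a + _]addrC addrK. Qed.

Lemma newton_sa a : cstar a = a -> cstar (newton a) = newton a.
Proof.
move=> sa; have sh : cstar (idem_defect a) = idem_defect a.
  by rewrite /idem_defect cstarB cstarM sa.
have ha : idem_defect a ** a = a ** idem_defect a.
  by rewrite /idem_defect cmulBl cmulBr cmulA.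
rewrite /newton; move: (idem_defect a) sh ha => h sh ha.
by rewrite mulr2n cstarB !cstarD !cstarM sh sa ha.
Qed.

Lemma newton_fix r a : r ** a = a -> r ** newton a = newton a.
Proof.
move=> ra; have rh : r ** idem_defect a = idem_defect a.
  by rewrite /idem_defect cmulBr cmulA ra.
rewrite /newton; move: (idem_defect a) rh => h rh.
by rewrite mulr2n cmulBr !cmulDr cmulA ra rh -mulr2n.
Qed.

Lemma rnorm_mulrn (V : normedModType R[i]) (x : V) n :
  rnorm (x *+ n) = rnorm x *+ n.
Proof. by rewrite /rnorm normrMn raddfMn. Qed.

(** For defects up to 1/8 the quadratic bound is at most half of the old defect,
    so that the iteration may be compared with a geometric series. *)
Lemma newton_step a (d : R) : cstar a = a -> d <= 8^-1 ->
  rnorm (idem_defect a) <= d ->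
  rnorm (newton a - a) <= 4 * d /\ rnorm (idem_defect (newton a)) <= d / 2.
Proof.
move=> sa d8 hd; set h := idem_defect a.
have d0 : 0 <= d := le_trans (rnorm_ge0 _) hd.
have a1 : rnorm a <= 1 + d := rnorm_approx_projection d0 sa hd.
have h0 := rnorm_ge0 h.
have hh : rnorm (h ** h) <= d * d.
  by apply: le_trans (cstar_rnormM _ _) _; rewrite ler_pM.
split.
  rewrite newton_dist -/h; apply: le_trans (rnormB_le _ _) _; rewrite rnorm_mulrn.
  have : rnorm (a ** h) <= (1 + d) * d.
    by apply: le_trans (cstar_rnormM _ _) _; rewrite ler_pM ?rnorm_ge0.
  move: hd; rewrite -/h; nra.
rewrite newton_defect -/h; apply: le_trans (rnormB_le _ _) _; rewrite !rnorm_mulrn.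
have : rnorm (h ** h ** h) <= d * d * d.
  by apply: le_trans (cstar_rnormM _ _) _; rewrite ler_pM ?rnorm_ge0.
move: hd; rewrite -/h; nra.
Qed.

(** The last conclusion keeps the projection in the corner that contains [a]: it
    holds for all iterates, which are polynomials in [a] without constant term,
    and passes to the limit. *)
Lemma projection_near a (d : R) : cstar a = a -> d <= 8^-1 ->
  rnorm (a ** a - a) <= d ->
  exists p, [/\ projection p, rnorm (p - a) <= 8 * d &
                forall r, r ** a = a -> r ** p = p].
Proof.
move=> sa d8 hd; have d0 : 0 <= d := le_trans (rnorm_ge0 _) hd.
pose u n := iter n newton a.
have us n : cstar (u n) = u n by elim: n => // n IH; rewrite /u iterS newton_sa.
have ud n : rnorm (idem_defect (u n)) <= d * geom R n.
  elim: n => [|n IH]; first by rewrite /geom expr0 invr1 mulr1.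
  have dn : d * geom R n <= 8^-1.
    by rewrite (le_trans _ d8)// ler_piMr// invf_le1 ?exprn_gt0// exprn_ege1// ler1n.
  have [_] := newton_step (us n) dn IH.
  by rewrite -iterS => /le_trans; apply; rewrite (geomS R n); lra.
have ust n : rnorm (u n.+1 - u n) <= 4 * (d * geom R n).
  have dn : d * geom R n <= 8^-1.
    by rewrite (le_trans _ d8)// ler_piMr// invf_le1 ?exprn_gt0// exprn_ege1// ler1n.
  by have [] := newton_step (us n) dn (ud n).
have [p hp] : exists l, forall n, rnorm (u n - l) <= geom R n *+ 2.
  apply: steps_cvg => n; apply: le_trans (ust n) _.
  by have := geom_gt0 R n; nra.
have ua n : rnorm (u n - a) <= 8 * d - 8 * d * geom R n.
  elim: n => [|n IH]; first by rewrite subrr rnorm0 /geom expr0 invr1 mulr1 subrr.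
  rewrite -(subrKA (u n)) (le_trans (rnormD _ _))//.
  by move: IH (ust n); rewrite (geomS R n); lra.
exists p; split; first split.
- apply/eqP; rewrite -subr_eq0; apply/eqP; apply: (@rnorm_geom_eq0 _ _ _ 4) => n.
  have -> : cstar p - p = (u n - p) - cstar (u n - p).
    by rewrite cstarB us opprB [RHS]addrC subrKA.
  by apply: le_trans (rnormB_le _ _) _; rewrite cstar_norm; have := hp n; lra.
- apply/eqP; rewrite -subr_eq0; apply/eqP.
  apply: (@rnorm_geom_eq0 _ _ _ (d + 2 + 2 * (rnorm p + (1 + d)))) => n.
  have g0 := geom_gt0 R n.
  have un1 : rnorm (u n) <= 1 + d.
    apply: rnorm_approx_projection => //; apply: le_trans (ud n) _.
    by rewrite ler_piMr// invf_le1 ?exprn_gt0// exprn_ege1// ler1n.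
  have -> : p ** p - p = idem_defect (u n) + (u n - p) - (p ** (u n - p) + (u n - p) ** u n).
    rewrite cmulBl cmulBr [p ** u n - _ + _]addrC /idem_defect !subrKA.
    by rewrite opprB [RHS]addrC subrKA.
  have := rnormB_le (idem_defect (u n) + (u n - p)) (p ** (u n - p) + (u n - p) ** u n).
  have := rnormD (idem_defect (u n)) (u n - p).
  have := rnormD (p ** (u n - p)) ((u n - p) ** u n).
  have := cstar_rnormM p (u n - p); have := cstar_rnormM (u n - p) (u n).
  have := hp n; have := ud n; have := rnorm_ge0 p; have := rnorm_ge0 (u n).
  have := rnorm_ge0 (u n - p).
  nra.
- apply: (@le_geom_eps _ _ _ 2) => n.
  rewrite -(subrKA (u n)) (le_trans (rnormD _ _))// rnormB addrC.
  have := hp n; have := ua n; have := geom_gt0 R n; nra.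
move=> r ra; have ru n : r ** u n = u n.
  by elim: n => // n IH; rewrite /u iterS newton_fix.
apply/eqP; rewrite -subr_eq0; apply/eqP.
apply: (@rnorm_geom_eq0 _ _ _ (2 * (rnorm r + 1))) => n.
have -> : r ** p - p = (u n - p) - r ** (u n - p).
  by rewrite cmulBr ru opprB [RHS]addrC subrKA.
apply: le_trans (rnormB_le _ _) _.
have := cstar_rnormM r (u n - p); have := hp n.
have := rnorm_ge0 r; have := rnorm_ge0 (u n - p); have := geom_gt0 R n; nra.
Qed.

End projection_stability.

(** * The theorem of Los

    The value of a formula in an ultraproduct is the limit of its values in the
    factors.  Quantifiers range over unit balls, so this needs that a formula is
    bounded on unit balls, uniformly in the algebra, and that elements of the
    unit ball of the ultraproduct lift to families in the unit balls. *)

Section ultralimits.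
Variables (R : realType) (J : Type) (U : set_system J) (UU : UltraFilter U).

Lemma ultra_bounded_cvg (f : J -> R) (M : R) : U [set j | `|f j| <= M] ->
  exists l : R, f j @[j --> U] --> l.
Proof.
move=> UM.
have FM : (f @ U) `[- M, M]%classic.
    rewrite /fmap /=; apply: (@filterS _ U _ _ _ _ UM) => j hj /=.
  by rewrite in_itv /= -ler_norml.
have [p [_ pU]] := segment_compact (fmap_proper_filter f _) FM.
exists p => N Np.
have [//|UN] := in_ultra_setVsetC (f @^-1` N) UU.
by have [x [xN' xN]] := pU (~` N) N UN Np; case: (xN' xN).
Qed.

(** Suprema commute with the limit as soon as values can be pushed from the
    factors to the limit and lifted back.  A family of near-optimal points
    witnesses one inequality, a lift of a near-optimal point the other. *)
Lemma ultra_sup (X : J -> Type) (Y : Type) (f : forall j, X j -> R) (g : Y -> R)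
    (M : R) :
  (forall j, inhabited (X j)) -> inhabited Y ->
  (forall j x, `|f j x| <= M) -> (forall y, `|g y| <= M) ->
  (forall x : forall j, X j, exists y, f j (x j) @[j --> U] --> g y) ->
  (forall y, exists x : forall j, X j, f j (x j) @[j --> U] --> g y) ->
  sup (range (f j)) @[j --> U] --> sup (range g).
Proof.
move=> X0 Y0 fM gM push lift.
have sf j : has_sup (range (f j)).
  have [x] := X0 j; split; first by exists (f j x), x.
  by exists M => _ [y _ <-]; apply: le_trans (ler_norm _) (fM _ _).
have sg : has_sup (range g).
  have [y] := Y0; split; first by exists (g y), y.
  by exists M => _ [z _ <-]; apply: le_trans (ler_norm _) (gM _).
apply/cvgrPdist_le => /= e e0.
have e20 : 0 < e / 2 by rewrite divr_gt0.
have near_sup j : exists x, sup (range (f j)) - e / 2 < f j x.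
  by have [_ [x _ <-] h] := sup_adherent e20 (sf j); exists x.
pose x j := sval (cid (near_sup j)).
have hx j : sup (range (f j)) - e / 2 < f j (x j) := svalP (cid (near_sup j)).
have [y xy] := push x.
have [_ [y' _ <-] hy'] := sup_adherent e20 sg.
have [x' xy'] := lift y'.
have [+ _] := @cvgrPdist_le R R J U _ (fun j => f j (x j)) (g y).
move=> /(_ xy _ e20) H.
have [+ _] := @cvgrPdist_le R R J U _ (fun j => f j (x' j)) (g y').
move=> /(_ xy' _ e20) H'.
apply: filterS2 H H' => j /=; rewrite !ler_distl => /andP[h1 h2] /andP[h3 h4].
have : g y <= sup (range g) by apply: sup_upper_bound => //; exists y.
have : f j (x' j) <= sup (range (f j)).
  by apply: sup_upper_bound => //; exists (x' j).
move: (hx j); lra.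
Qed.

End ultralimits.

Section formula_bounds.
Variable R : realType.

Definition in_ball (A : cstarAlgType R) (e : nat -> A) :=
  forall x, rnorm (e x) <= 1.

Lemma in_ball_update (A : cstarAlgType R) (e : nat -> A) x a :
  in_ball e -> rnorm a <= 1 -> in_ball (update e x a).
Proof. by move=> eb ab y; rewrite /update; case: ifP. Qed.

Lemma peval_bounded (P : starpoly R) :
  exists M : R, forall (A : cstarAlgType R) (e : nat -> A),
    in_ball e -> rnorm (peval e P) <= M.
Proof.
elim: P => [x|P [M hM] Q [N hN]|c P [M hM]|P [M hM] Q [N hN]|P [M hM]].
- by exists 1 => A e; apply.
- exists (M + N) => A e eb /=.
  by rewrite (le_trans (rnormD _ _))// lerD ?hM ?hN.
- exists (rnorm c * M) => A e eb /=.
  by rewrite rnormZ ler_wpM2l ?rnorm_ge0 ?hM.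
- exists (M * N) => A e eb /=.
  by rewrite (le_trans (cstar_rnormM _ _))// ler_pM ?rnorm_ge0 ?hM ?hN.
by exists M => A e eb /=; rewrite cstar_norm hM.
Qed.

(** A connective is bounded on bounded arguments, because boxes are compact. *)
Lemma continuous_box_bounded k (u : 'rV[R]_k -> R) (M : 'I_k -> R) :
  continuous u -> exists N, forall v : 'rV[R]_k,
    (forall i, `|v 0 i| <= M i) -> `|u v| <= N.
Proof.
move=> cu.
have cbox := @rV_compact R k (fun i => `[- M i, M i]%classic)
  (fun i => @segment_compact R _ _).
have := @compact_bounded R R _ (continuous_compact (continuous_subspaceT cu) cbox).
move=> [N0 [_ hN]]; exists (N0 + 1) => v hv.
by apply: hN; [rewrite ltrDl|exists v => // i /=; rewrite in_itv /= -ler_norml].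
Qed.

Lemma feval_bounded (phi : formula R) :
  exists M : R, forall (A : cstarAlgType R) (e : nat -> A),
    in_ball e -> `|feval phi e| <= M.
Proof.
elim: phi => [P|k u cu f IH|x psi [M hM]|x psi [M hM]].
- have [M hM] := peval_bounded P; exists M => A e eb /=.
  by rewrite ger0_norm ?rnorm_ge0 ?hM.
- have /choice [M hM] := IH.
  have [N hN] := continuous_box_bounded M cu.
  by exists N => A e eb /=; apply: hN => i; rewrite mxE hM.
all: exists M => A e eb /=.
all: have ne : unit_ball A 0 by rewrite /unit_ball /= rnorm0.
all: have bnd a : unit_ball A a -> - M <= feval psi (update e x a) <= M
  by move=> ab; rewrite -ler_norml hM//; exact: in_ball_update.
all: have b0 := bnd 0 ne; rewrite ler_norml; apply/andP; split.
- apply: le_trans (proj1 (andP b0)) _; apply: sup_upper_bound; last by exists 0.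
  split; first by exists (feval psi (update e x 0)), 0.
  by exists M => _ [a ab <-]; have /andP[] := bnd a ab.
- apply: ge_sup; first by exists (feval psi (update e x 0)), 0.
  by move=> _ [a ab <-]; have /andP[] := bnd a ab.
- apply: lb_le_inf; first by exists (feval psi (update e x 0)), 0.
  by move=> _ [a ab <-]; have /andP[] := bnd a ab.
apply: le_trans (proj2 (andP b0)); apply: ge_inf; last by exists 0.
by exists (- M) => _ [a ab <-]; have /andP[] := bnd a ab.
Qed.

End formula_bounds.

Section los.
Variables (R : realType) (J : Type) (A : J -> cstarAlgType R).
Variables (U : set_system J) (UU : UltraFilter U).
Local Notation B := (ultraprod A UU : cstarAlgType R).
Local Notation pi := (@upi R J A U UU).

Lemma peval_ultraprod (e : nat -> bfam A) (P : starpoly R) :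
  exists2 b : bfam A, (forall j, b j = peval (fun x => e x j) P) &
    pi b = peval (fun x => pi (e x) : B) P.
Proof.
elim: P => [x|P [b hb eb] Q [c hc ec]|z P [b hb eb]|P [b hb eb] Q [c hc ec]|P [b hb eb]].
- by exists (e x).
- by exists (b + c) => [j|]; [rewrite bfamDE hb hc|rewrite upiD eb ec].
- exists (z *: b) => [j|] /=; first by rewrite -hb.
  by rewrite upiZ eb.
- exists (bfamM b c) => [j|] /=; first by rewrite -hb -hc.
  by rewrite upiM eb ec.
exists (bfamS b) => [j|] /=; first by rewrite -hb.
by rewrite upiS eb.
Qed.

(** Radial truncation of a representing family: the truncation at radius 1 moves
    each member by the excess of its norm over 1, which tends to 0. *)
Lemma lift_ball (b : B) : rnorm b <= 1 ->
  exists2 a : bfam A, pi a = b & forall j, rnorm (a j) <= 1.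
Proof.
move=> b1; pose c := urepr b.
pose f j : A j := (Num.max 1 (rnorm (c j)))^-1%:C *: c j.
have m0 j : 0 < Num.max 1 (rnorm (c j)) by rewrite lt_max ltr01.
have f1 j : rnorm (f j) <= 1.
  rewrite /f rnormZ rnorm_real ?invr_ge0 ?(ltW (m0 j))// mulrC ler_pdivrMr// mul1r.
  by rewrite le_max lexx orbT.
have fb : exists M : R, forall j, rnorm (f j) <= M by exists 1.
exists (BFam fb) => //; rewrite -[b]ureprK; apply/upi_eq; apply: upi0_le.
have bl : ulim U c = rnorm b by rewrite -(rnorm_upi UU c) ureprK.
have defect j : rnorm ((BFam fb - c) j) = Num.max 1 (rnorm (c j)) - 1.
  rewrite bfamDE bfamNE /= /f -[X in _ - X]scale1r -scalerBl rnormZ.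
  rewrite -rnormN opprB -(rmorph1 (real_complex R)) -rmorphB rnorm_real; last first.
    by rewrite subr_ge0 invf_le1// le_max lexx.
  rewrite mulrBl mul1r.
  have [c1|c1] := leP (rnorm (c j)) 1; first by rewrite invr1 mul1r !subrr.
  by rewrite mulVf ?gt_eqF// (lt_trans ltr01).
rewrite le_eqVlt; apply/orP; left; apply/eqP; apply: ulim_uniq.
apply/cvgrPdist_le => /= d d0.
have [+ _] := @cvgrPdist_le R R J U _ (fun j => rnorm (c j)) (ulim U c).
move=> /(_ (@ulimP R J A U UU c) _ d0); apply: filterS => j /=.
rewrite defect bl sub0r normrN ler_distl => /andP[h1 h2].
rewrite ger0_norm ?subr_ge0 ?le_max ?lexx//.
by rewrite lerBlDl ge_max; apply/andP; split; lra.
Qed.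

Lemma cvg_row k (f : J -> 'rV[R]_k) (l : 'rV[R]_k) :
  (forall i, f j 0 i @[j --> U] --> l 0 i) -> f j @[j --> U] --> l.
Proof.
move=> fl; apply/cvg_mx_entourageP => E entE.
have H i : U [set j | (l 0 i, f j 0 i) \in E].
  have [+ _] := @cvg_entourageP R ((fun j => f j 0 i) @ U) _ (l 0 i).
  move=> /(_ (fl i) _ entE) h.
  by apply: (@filterS _ U _ _ _ _ h) => j /= ?; rewrite inE.
have FU : Filter U by typeclasses eauto.
have h := @filter_forall _ _ _ _ FU H.
apply: (@filterS _ U _ _ _ _ h) => j /= hj i i'; rewrite (ord1 i); exact: hj.
Qed.

Theorem los (phi : formula R) (e : nat -> bfam A) :
  (forall x j, rnorm (e x j) <= 1) ->
  feval phi (fun x => e x j) @[j --> U] --> feval phi (fun x => pi (e x) : B).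
Proof.
have upd (f : nat -> bfam A) x (a : bfam A) j :
    (fun y => update f x a y j) = update (fun y => f y j) x (a j).
  by apply: funext => y; rewrite /update; case: ifP.
have updpi (f : nat -> bfam A) x (a : bfam A) :
    (fun y => pi (update f x a y) : B) = update (fun y => pi (f y) : B) x (pi a).
  by apply: funext => y; rewrite /update; case: ifP.
(* Both quantifiers at once: s = 1 for sup, and s = -1 for inf S = - sup (- S). *)
have quant x (psi : formula R) (f : nat -> bfam A) (s : R) : `|s| = 1 ->
    (forall f : nat -> bfam A, (forall x j, rnorm (f x j) <= 1) ->
     feval psi (fun x => f x j) @[j --> U] --> feval psi (fun x => pi (f x) : B)) ->
    (forall x j, rnorm (f x j) <= 1) ->
    sup [set s * feval psi (update (fun y => f y j) x a) | a in unit_ball (A j)]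
      @[j --> U] -->
    sup [set s * feval psi (update (fun y => pi (f y) : B) x a) | a in unit_ball B].
  move=> s1 IH fb.
  pose X j := {a : A j | rnorm a <= 1}; pose Y := {b : B | rnorm b <= 1}.
  have rangeE (C : cstarAlgType R) (g : nat -> C) :
      [set s * feval psi (update g x a) | a in unit_ball C] =
      range (fun a : {a : C | rnorm a <= 1} => s * feval psi (update g x (sval a))).
    apply/seteqP; split => [_ [a ab <-]|_ [[a ab] _ <-]]; last by exists a.
    by exists (exist _ a ab).
  under eq_fun do rewrite rangeE; rewrite rangeE.
  have [M hM] := feval_bounded psi.
  have fbpi : in_ball (fun y => pi (f y) : B).
    by move=> y; rewrite rnorm_upi; apply: ulim_le.
  have pair (a : bfam A) : (forall j, rnorm (a j) <= 1) ->
      s * feval psi (update (fun y => f y j) x (a j)) @[j --> U] -->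
      s * feval psi (update (fun y => pi (f y) : B) x (pi a)).
    move=> ab; apply: cvgM; first exact: cvg_cst.
    have := IH (update f x a); rewrite updpi; under eq_fun do rewrite upd.
    by apply => y j; rewrite /update; case: ifP.
  apply: (@ultra_sup R J U UU X Y
            (fun j a => s * feval psi (update (fun y => f y j) x (sval a)))
            (fun a => s * feval psi (update (fun y => pi (f y) : B) x (sval a))) M).
  - by move=> j; exists; exists 0; rewrite rnorm0.
  - by exists; exists 0; rewrite rnorm0.
  - move=> j [a ab]; rewrite normrM s1 mul1r hM//.
    by apply: in_ball_update => // y; apply: fb.
  - move=> [a ab]; rewrite normrM s1 mul1r hM//; exact: in_ball_update.
  - move=> a; have ab : exists M : R, forall j, rnorm (sval (a j)) <= M.
      by exists 1 => j; case: (a j).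
    have pb : rnorm (pi (BFam ab) : B) <= 1.
      by rewrite rnorm_upi; apply: ulim_le => j /=; case: (a j).
    exists (exist (fun b : B => is_true (rnorm b <= 1)) _ pb); apply: (pair (BFam ab)) => j /=; by case: (a j).
  move=> [b bb]; have [a ab a1] := lift_ball bb.
  exists (fun j => exist (fun b : A j => is_true (rnorm b <= 1)) (a j) (a1 j)) => /=; rewrite -ab; exact: pair.
elim: phi e => [P|k u cu f IH|x psi IH|x psi IH] e eb /=.
- have [b hb <-] := peval_ultraprod e P; rewrite rnorm_upi.
  under eq_fun do rewrite -hb; exact: ulimP.
- apply: (@continuous_cvg J _ _ U _ _ u); first exact: cu.
  by apply: cvg_row => i; rewrite mxE; under eq_fun do rewrite mxE; apply: IH.
- have := quant x psi e 1 (normr1 _) IH eb.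
  have E (C : cstarAlgType R) (g : nat -> C) :
      [set 1 * feval psi (update g x a) | a in unit_ball C] =
      [set feval psi (update g x a) | a in unit_ball C].
    by congr image; apply: funext => a; rewrite mul1r.
  by rewrite E; under eq_fun do rewrite E.
have := quant x psi e (-1) (normrN1 _) IH eb.
have E (C : cstarAlgType R) (g : nat -> C) :
    inf [set feval psi (update g x a) | a in unit_ball C] =
    - sup [set -1 * feval psi (update g x a) | a in unit_ball C].
  rewrite /inf image_comp; congr (- sup _); congr image.
  by apply: funext => a /=; rewrite mulN1r.
by rewrite E; under [X in X @ _ --> _]eq_fun do rewrite E; apply: cvgN.
Qed.

End los.

(** * A calculus of formulas

    Continuous connectives, finite sums and minima, and blocks of quantifiers,
    with their scoping and their values. *)

Section formula_combinators.
Variable R : realType.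
Implicit Types (phi psi : formula R) (P Q : starpoly R).

Definition PSub P Q := PAdd P (PScale (-1) Q).

Lemma peval_sub (A : cstarAlgType R) (e : nat -> A) P Q :
  peval e (PSub P Q) = peval e P - peval e Q.
Proof. by rewrite /= scaleN1r. Qed.

Lemma cvg_coord k (i : 'I_k) (v : 'rV[R]_k) : w 0 i @[w --> v] --> v 0 i.
Proof. exact: (@coord_continuous R 1 k 0 i v). Qed.

Lemma addf_continuous : continuous (fun v : 'rV[R]_2 => v 0 0 + v 0 1).
Proof. by move=> v; exact: (continuousD (@cvg_coord _ 0 v) (@cvg_coord _ 1 v)). Qed.

Lemma mulf_continuous : continuous (fun v : 'rV[R]_2 => v 0 0 * v 0 1).
Proof. by move=> v; exact: (continuousM (@cvg_coord _ 0 v) (@cvg_coord _ 1 v)). Qed.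

Lemma minf_continuous : continuous (fun v : 'rV[R]_2 => Num.min (v 0 0) (v 0 1)).
Proof. by move=> v; exact: (continuous_min (@cvg_coord _ 0 v) (@cvg_coord _ 1 v)). Qed.

Lemma constf_continuous (c : R) : continuous (fun v : 'rV[R]_0 => c).
Proof. by move=> v; exact: cst_continuous. Qed.

Lemma scalef_continuous (c : R) : continuous (fun v : 'rV[R]_1 => c * v 0 0).
Proof.
by move=> v; exact: (continuousM (@cst_continuous _ _ c v) (@cvg_coord _ 0 v)).
Qed.

Lemma distf_continuous (c : R) : continuous (fun v : 'rV[R]_1 => `|v 0 0 - c|).
Proof.
move=> v; apply: (@continuous_comp _ _ _ (fun w : 'rV[R]_1 => w 0 0 - c) Num.norm).
  exact: (continuousB (@cvg_coord _ 0 v) (@cst_continuous _ _ c v)).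
exact: (@norm_continuous R R).
Qed.

Definition pair_family phi psi (i : 'I_2) := if i == 0 then phi else psi.

Definition fadd phi psi := FConn addf_continuous (pair_family phi psi).
Definition fmul phi psi := FConn mulf_continuous (pair_family phi psi).
Definition fmin phi psi := FConn minf_continuous (pair_family phi psi).
Definition fconst c := FConn (@constf_continuous c) (fun=> FNorm (PVar R 0)).
Definition fscale c phi := FConn (@scalef_continuous c) (fun=> phi).
Definition fdist phi c := FConn (@distf_continuous c) (fun=> phi).
Definition fsum (I : Type) (r : seq I) (F : I -> formula R) :=
  foldr (fun i => fadd (F i)) (fconst 0) r.
(** The constant [c] is the minimum over the empty sequence. *)
Definition fmins (I : Type) (c : R) (r : seq I) (F : I -> formula R) :=
  foldr (fun i => fmin (F i)) (fconst c) r.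
Definition fsups (xs : seq nat) phi := foldr (@FSup R) phi xs.
Definition finfs (xs : seq nat) phi := foldr (@FInf R) phi xs.

Definition below (k : nat) phi := forall x, free_in x phi -> (x < k)%N.

Lemma below_sentence phi : below 0 phi -> sentence phi.
Proof. by move=> h x /h. Qed.

Lemma below_norm k P : (forall x, pvar_in x P -> (x < k)%N) -> below k (FNorm P).
Proof. by move=> h x /= /h. Qed.

Lemma below_conn k n (u : 'rV[R]_n -> R) (cu : continuous u) f :
  (forall i, below k (f i)) -> below k (FConn cu f).
Proof. by move=> h x /= [i /h]. Qed.

Lemma below_pair k phi psi : below k phi -> below k psi ->
  forall i, below k (pair_family phi psi i).
Proof. by move=> h1 h2 i; rewrite /pair_family; case: ifP. Qed.

Lemma below_fsum k I (r : seq I) F : (forall i, below k (F i)) -> below k (fsum r F).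
Proof.
move=> h; elim: r => [|i r IH] /=; first by apply: below_conn => -[].
by apply: below_conn; apply: below_pair.
Qed.

Lemma below_quant k phi : below k.+1 phi -> below k (FSup k phi) /\ below k (FInf k phi).
Proof.
by move=> h; split=> x /= [/eqP xk /h]; rewrite ltnS leq_eqVlt (negPf xk).
Qed.

Lemma below_block k n phi : below (k + n) phi ->
  below k (fsups (iota k n) phi) /\ below k (finfs (iota k n) phi).
Proof.
elim: n k => [|n IH] k /=; first by rewrite addn0.
rewrite -addSnnS => /IH[h1 h2].
by split; [case: (below_quant h1)|case: (below_quant h2)].
Qed.

Section values.
Variable A : cstarAlgType R.
Implicit Types (e g : nat -> A).

Lemma feval_fadd phi psi e : feval (fadd phi psi) e = feval phi e + feval psi e.
Proof. by rewrite /= !mxE. Qed.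

Lemma feval_fmul phi psi e : feval (fmul phi psi) e = feval phi e * feval psi e.
Proof. by rewrite /= !mxE. Qed.

Lemma feval_fmin phi psi e :
  feval (fmin phi psi) e = Num.min (feval phi e) (feval psi e).
Proof. by rewrite /= !mxE. Qed.

Lemma feval_fscale c phi e : feval (fscale c phi) e = c * feval phi e.
Proof. by rewrite /= !mxE. Qed.

Lemma feval_fdist phi c e : feval (fdist phi c) e = `|feval phi e - c|.
Proof. by rewrite /= !mxE. Qed.

Lemma feval_fsum I (r : seq I) F e :
  feval (fsum r F) e = \sum_(i <- r) feval (F i) e.
Proof.
by elim: r => [|i r IH]; rewrite ?big_nil// big_cons -IH -feval_fadd.
Qed.

Lemma fmins_le (I : eqType) c (r : seq I) F e i :
  i \in r -> feval (fmins c r F) e <= feval (F i) e.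
Proof.
elim: r => // j r IH; rewrite inE [fmins _ _ _]/(fmin _ _) feval_fmin => /orP[/eqP <-|/IH h].
  by rewrite ge_min lexx.
by rewrite ge_min h orbT.
Qed.

Lemma fmins_ge (I : eqType) (c d : R) (r : seq I) F e :
  d <= c -> (forall i, i \in r -> d <= feval (F i) e) -> d <= feval (fmins c r F) e.
Proof.
move=> dc; elim: r => // j r IH h; rewrite [fmins _ _ _]/(fmin _ _) feval_fmin le_min.
by rewrite h ?mem_head//= IH// => i ir; apply: h; rewrite inE ir orbT.
Qed.

Lemma quant_bounded phi e x : in_ball e ->
  exists M : R, forall a, unit_ball A a -> - M <= feval phi (update e x a) <= M.
Proof.
move=> eb; have [M hM] := feval_bounded phi; exists M => a ab.
by rewrite -ler_norml hM//; exact: in_ball_update.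
Qed.

Lemma unit_ball0 : unit_ball A 0.
Proof. by rewrite /unit_ball /= rnorm0. Qed.

Lemma fsup_ub phi e x a : in_ball e -> rnorm a <= 1 ->
  feval phi (update e x a) <= feval (FSup x phi) e.
Proof.
move=> eb ab; have [M hM] := quant_bounded phi x eb.
apply: sup_upper_bound; last by exists a.
split; first by exists (feval phi (update e x a)), a.
by exists M => _ [b bb <-]; have /andP[] := hM b bb.
Qed.

Lemma fsup_le phi e x c :
  (forall a, rnorm a <= 1 -> feval phi (update e x a) <= c) ->
  feval (FSup x phi) e <= c.
Proof.
move=> h; apply: ge_sup; last by move=> _ [a ab <-]; exact: h.
by exists (feval phi (update e x 0)), 0 => //; exact: unit_ball0.
Qed.

Lemma finf_lb phi e x a : in_ball e -> rnorm a <= 1 ->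
  feval (FInf x phi) e <= feval phi (update e x a).
Proof.
move=> eb ab; have [M hM] := quant_bounded phi x eb.
apply: ge_inf; last by exists a.
by exists (- M) => _ [b bb <-]; have /andP[] := hM b bb.
Qed.

Lemma finf_lt phi e x c : in_ball e -> feval (FInf x phi) e < c ->
  exists2 a, rnorm a <= 1 & feval phi (update e x a) < c.
Proof.
move=> eb h; have [M hM] := quant_bounded phi x eb.
have d0 : 0 < c - feval (FInf x phi) e by rewrite subr_gt0.
have hi : has_inf [set feval phi (update e x a) | a in unit_ball A].
  split; first by exists (feval phi (update e x 0)), 0 => //; exact: unit_ball0.
  by exists (- M) => _ [b bb <-]; have /andP[] := hM b bb.
have [_ [a ab <-]] := inf_adherent d0 hi.
by rewrite /= addrC subrK; exists a.
Qed.

Definition override e (xs : seq nat) g : nat -> A :=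
  fun y => if y \in xs then g y else e y.

Lemma in_ball_override e xs g : in_ball e -> in_ball g -> in_ball (override e xs g).
Proof. by move=> eb gb x; rewrite /override; case: ifP. Qed.

Lemma override_cons e x xs g :
  override (update e x (g x)) xs g = override e (x :: xs) g.
Proof.
apply: funext => y; rewrite /override /update inE.
by case: (y \in xs); rewrite ?orbT ?orbF//; case: eqP => // ->.
Qed.

Lemma fsups_ub phi e xs g : in_ball e -> in_ball g ->
  feval phi (override e xs g) <= feval (fsups xs phi) e.
Proof.
move=> + gb; elim: xs e => [|x xs IH] e eb /=; first by [].
rewrite -override_cons; apply: le_trans (fsup_ub _ _ eb (gb x)).
by apply: IH; exact: in_ball_update.
Qed.

(** A block of quantifiers is a single quantifier over valuations.  When a
    variable occurs twice in the block, the inner occurrence binds it; this is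
    why the witness below is patched only outside of the inner block. *)
Lemma fsups_le phi e xs c : in_ball e ->
  (forall g, in_ball g -> feval phi (override e xs g) <= c) ->
  feval (fsups xs phi) e <= c.
Proof.
elim: xs e => [|x xs IH] e eb h /=; first by apply: (h e).
apply: fsup_le => a ab; apply: IH; first exact: in_ball_update.
move=> g gb; have := h (fun y => if y \in xs then g y else a).
have -> : override (update e x a) xs g =
          override e (x :: xs) (fun y => if y \in xs then g y else a).
  apply: funext => y; rewrite /override /update inE.
  by case: (y \in xs); rewrite ?orbT ?orbF.
by apply => y; case: ifP.
Qed.

Lemma finfs_lb phi e xs g : in_ball e -> in_ball g ->
  feval (finfs xs phi) e <= feval phi (override e xs g).
Proof.
move=> + gb; elim: xs e => [|x xs IH] e eb /=; first by [].
rewrite -override_cons; apply: le_trans (finf_lb _ _ eb (gb x)) _.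
by apply: IH; exact: in_ball_update.
Qed.

Lemma finfs_lt phi e xs c : in_ball e -> feval (finfs xs phi) e < c ->
  exists2 g, in_ball g & feval phi (override e xs g) < c.
Proof.
elim: xs e => [|x xs IH] e eb /=; first by exists e.
move=> /(finf_lt eb)[a ab] /IH[|g gb hg]; first exact: in_ball_update.
exists (fun y => if y \in xs then g y else a); first by move=> y; case: ifP.
suff -> : override e (x :: xs) (fun y => if y \in xs then g y else a) =
          override (update e x a) xs g by [].
apply: funext => y; rewrite /override /update inE.
by case: (y \in xs); rewrite ?orbT ?orbF.
Qed.

End values.
End formula_combinators.

(** * Dimension *)

Section dyadic_covering.
Variables (R : realType) (A : cstarAlgType R).

(** If finitely many points [v i] are 1/2-dense in the unit ball, iterating
    [a |-> 2 (a - v i)] expands every [a] in the ball as a dyadic series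
    [\sum_m 2^-m v (i_m)].  Collecting the terms with equal index turns it into
    a linear combination of the [v i], and no closedness of their span has to be
    known. *)
Lemma covered_finite_dimensional (k : nat) (v : 'I_k -> A) :
  (forall a, rnorm a <= 1 -> exists i, rnorm (a - v i) <= 2^-1) ->
  finite_dimensional A.
Proof.
move=> cov.
have spanned a : rnorm a <= 1 -> exists c : 'I_k -> R[i], a = \sum_i c i *: v i.
  move=> a1.
  have next (x : {b : A | rnorm b <= 1}) :
      exists y : 'I_k * {b : A | rnorm b <= 1}, sval y.2 = 2 *: (sval x - v y.1).
    case: x => x x1 /=; have [i hi] := cov x x1.
    have y1 : rnorm (2 *: (x - v i)) <= 1.
      rewrite scaler_nat rnorm_mulrn; lra.
    by exists (i, exist (fun b : A => is_true (rnorm b <= 1)) _ y1).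
  have /choice[f hf] := next.
  pose x n := iter n (fun x => (f x).2) (exist (fun b : A => is_true (rnorm b <= 1)) a a1).
  pose c n (i : 'I_k) : R[i] := \sum_(m < n | (f (x m)).1 == i) (geom R m)%:C.
  have ac n : a = \sum_i c n i *: v i + (geom R n)%:C *: sval (x n).
    elim: n => [|n IH].
      by rewrite big1 => [|i _]; rewrite ?/c ?big_ord0 ?scale0r// /geom expr0 invr1 scale1r add0r.
    have E : \sum_i c n.+1 i *: v i = \sum_i c n i *: v i + (geom R n)%:C *: v (f (x n)).1.
      rewrite (bigD1 (f (x n)).1)//= [in RHS](bigD1 (f (x n)).1)//= addrAC.
      congr (_ + _); last first.
        apply: eq_bigr => i ni; rewrite /c big_mkcond big_ord_recr/= -big_mkcond/=.
        by rewrite eq_sym (negPf ni) addr0.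
      by rewrite /c big_mkcond big_ord_recr/= -big_mkcond/= eqxx scalerDl.
    rewrite E [x n.+1]/((f (x n)).2) hf scalerA.
    have -> : (geom R n.+1)%:C * 2 = (geom R n)%:C.
      by rewrite [geom R n]geomS raddfMn mulr_natr.
    by rewrite scalerBr addrA addrAC addrK.
  have cstep i n : rnorm (c n.+1 i - c n i) <= geom R n.
    rewrite /c big_mkcond big_ord_recr/= -big_mkcond/= [X in rnorm X]addrC addKr.
    case: ifP => _; last by rewrite rnorm0 ltW// geom_gt0.
    by rewrite rnorm_real ?(ltW (geom_gt0 _ _)).
  have /choice[l hl] i := complex_steps_cvg (cstep i).
  exists l; apply/eqP; rewrite -subr_eq0; apply/eqP; apply: rnorm_eq0.
  apply/le_anti; rewrite rnorm_ge0 andbT; apply/ler_addgt0Pr => d d0; rewrite add0r.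
  have [n hn] := geom_smallM (1 + \sum_i 4 * rnorm (v i)) d0.
  apply: le_trans (ltW hn).
  rewrite (ac n) addrAC -sumrB (le_trans (rnormD _ _))// addrC mulrDl mul1r lerD//.
    rewrite rnormZ rnorm_real ?(ltW (geom_gt0 _ _))//.
    by rewrite ler_piMr ?(ltW (geom_gt0 _ _))//; case: (x n).
  apply: le_trans (rnorm_sum _ _) _; rewrite mulr_suml; apply: ler_sum => i _.
  rewrite -scalerBl rnormZ mulrAC ler_wpM2r ?rnorm_ge0//; exact: hl.
exists k, v => a.
have [->|a0] := eqVneq a 0.
  by exists (fun=> 0); rewrite big1// => i _; rewrite scale0r.
have na0 := rnorm_gt0 a0.
have [|c hc] := spanned ((rnorm a)^-1%:C *: a); first by rewrite rnorm_normalize.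
exists (fun i => (rnorm a)%:C * c i).
under eq_bigr do rewrite -scalerA.
rewrite -scaler_sumr -hc scalerA -rmorphM divff ?gt_eqF// scale1r//.
Qed.

(** Otherwise a maximal separated family would be 1/2-dense in the ball. *)
Lemma separated_points : ~ finite_dimensional A -> forall k,
  exists g : nat -> A, in_ball g /\
    forall i j, (i < j < k)%N -> 2^-1 <= rnorm (g i - g j).
Proof.
move=> nfd; elim=> [|k [g [gb gs]]].
  by exists (fun=> 0); split=> [x|i j]; rewrite ?rnorm0 ?ler01// ltn0 andbF.
have [a [a1 ha]] : exists a, rnorm a <= 1 /\ forall i : 'I_k, 2^-1 <= rnorm (a - g i).
  apply: contrapT => no; apply: nfd.
  apply: (@covered_finite_dimensional k (fun i => g i)) => a a1.
  apply: contrapT => no'; apply: no; exists a; split=> // i.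
  by rewrite leNgt; apply/negP => h; apply: no'; exists i; exact: ltW.
exists (update g k a); split; first exact: in_ball_update.
move=> i j /andP[ij]; rewrite ltnS leq_eqVlt /update.
move=> /orP[/eqP jk|jk].
  by subst j; rewrite eqxx (ltn_eqF ij) rnormB; exact: (ha (Ordinal ij)).
by rewrite (ltn_eqF jk) (ltn_eqF (ltn_trans ij jk)); apply: gs; rewrite ij.
Qed.

End dyadic_covering.

Section matrix_ball_covering.
Variables (R : realType) (n : nat).

Lemma rnormC_le (z : R[i]) : rnorm z <= `|complex.Re z| + `|complex.Im z|.
Proof.
rewrite -(@lecR R) rnormE normc_def lecR -[leRHS]ger0_norm ?addr_ge0//.
rewrite -sqrtr_sqr ler_sqrt ?sqr_ge0// sqrrD !real_normK ?num_real//.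
by rewrite lerD2r lerDl mulrn_wge0// mulr_ge0.
Qed.

Lemma Re_le_rnorm (z : R[i]) : `|complex.Re z| <= rnorm z.
Proof. by rewrite -(@lecR R) rnormE normc_ge_Re. Qed.

Lemma Im_le_rnorm (z : R[i]) : `|complex.Im z| <= rnorm z.
Proof.
rewrite -(@lecR R) rnormE normc_def lecR -sqrtr_sqr ler_sqrt ?lerDr ?sqr_ge0//.
by rewrite addr_ge0 ?sqr_ge0.
Qed.

Let m := (8 * (n * n)).+1.

(** The interval [-1, 1] is cut into [2 m] cells of length [1 / m]; the value of
    [m] makes [n^2] entrywise errors of size [2 / m] sum up to at most 1/4. *)
Definition cell (x : R) : 'I_(2 * m).+1 := inord (Num.trunc ((x + 1) * m%:R)).

Lemma cell_close (x y : R) : `|x| <= 1 -> `|y| <= 1 -> cell x = cell y ->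
  `|x - y| <= m%:R^-1.
Proof.
have m0 : 0 < m%:R :> R by rewrite ltr0n.
have bnd (z : R) : `|z| <= 1 -> 0 <= (z + 1) * m%:R /\
    (Num.trunc ((z + 1) * m%:R) < (2 * m).+1)%N.
  rewrite ler_norml => /andP[z1 z2].
  have h0 : 0 <= (z + 1) * m%:R by rewrite mulr_ge0 ?ler0n//; lra.
  split=> //; rewrite ltnS -(ler_nat R); have /andP[t1 _] := truncn_itv h0; apply: le_trans t1 _.
  by rewrite natrM ler_pM2r//; lra.
move=> /bnd[hx tx] /bnd[hy ty] /(congr1 val); rewrite /= !inordK// => E.
have /andP[x1 x2] := truncn_itv hx; have /andP[y1 y2] := truncn_itv hy.
rewrite -(ler_pM2r m0) mulVf ?gt_eqF// -{1}(gtr0_norm m0) -normrM ler_norml.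
move: x1 x2 y1 y2; rewrite E -[_.+1%:R]natr1.
move=> x1 x2 y1 y2; apply/andP; split; lra.
Qed.

(** Pigeonhole: two of many matrices in the unit ball have all entries in the same
    cells. *)
Lemma matrix_ball_close_points : exists K, forall k, (K <= k)%N ->
  forall g : nat -> matalg R n, in_ball (A := (matalg R n : cstarAlgType R)) g ->
  exists i j, (i < j < k)%N /\ rnorm (g i - g j) <= 4^-1.
Proof.
pose T := {ffun 'I_n * 'I_n -> 'I_(2 * m).+1 * 'I_(2 * m).+1}.
exists #|T|.+1 => k Kk g gb.
pose h (i : 'I_k) : T := [ffun ab => (cell (complex.Re ((g i : 'M_n) ab.1 ab.2)),
                                      cell (complex.Im ((g i : 'M_n) ab.1 ab.2)))].
have close (i j : 'I_k) : h i = h j -> rnorm (g i - g j) <= 4^-1.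
  move=> hij; rewrite matalg_rnormE; apply: le_trans (opnorm_le_sum _) _.
  have ent (l : 'I_k) a b : rnorm ((g l : 'M_n) a b) <= 1.
    by apply: le_trans (entry_le_opnorm _ _ _) _; rewrite -matalg_rnormE; apply: gb.
  have le_entry a b : rnorm ((g i - g j : 'M_n) a b) <= 2 * m%:R^-1.
    have := congr1 (fun f : T => f (a, b)) hij; rewrite !ffunE /= => -[hr hi].
    rewrite !mxE; apply: le_trans (rnormC_le _) _; rewrite !raddfB mulr_natl mulr2n.
    apply: lerD; [apply: cell_close hr|apply: cell_close hi].
    + exact: le_trans (Re_le_rnorm _) (ent _ a b).
    + exact: le_trans (Re_le_rnorm _) (ent _ a b).
    + exact: le_trans (Im_le_rnorm _) (ent _ a b).
    exact: le_trans (Im_le_rnorm _) (ent _ a b).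
  apply: (@le_trans _ _ (\sum_(b < n) \sum_(a < n) 2 * m%:R^-1)).
    by apply: ler_sum => b _; apply: ler_sum => a _.
  rewrite !sumr_const !card_ord -mulrnA -[X in X <= _]mulr_natr mulrAC ler_pdivrMr ?ltr0n//.
  by rewrite /m -natr1 !natrM; lra.
have : ~~ injectiveb h.
  apply/negP => /injectiveP /leq_card; rewrite card_ord leqNgt.
  by rewrite Kk.
move=> /injectivePn[i [j ij hij]].
have [lij|lji|eij] := ltngtP i j.
- by exists i, j; rewrite lij ltn_ord close.
- by exists j, i; rewrite lji ltn_ord close.
by rewrite (val_inj eij) eqxx in ij.
Qed.

End matrix_ball_covering.

Section matrix_limits.
Variable R : realType.

Lemma in_ball0 (A : cstarAlgType R) : in_ball (fun=> 0 : A).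
Proof. by move=> x; rewrite rnorm0. Qed.

Lemma le_dist_trans (x y c e : R) : `|x - y| <= e -> y <= c -> x <= c + e.
Proof. by rewrite ler_distl => /andP[]; lra. Qed.

Definition separation (k : nat) : formula R :=
  fsups (iota 0 k)
    (fmins 2 [seq ij <- [seq (i, j) | i <- iota 0 k, j <- iota 0 k] | (ij.1 < ij.2)%N]
      (fun ij => FNorm (PSub (PVar R ij.1) (PVar R ij.2)))).

Lemma free_in_fmins (I : eqType) c (r : seq I) (F : I -> formula R) x :
  free_in x (fmins c r F) -> exists2 i, i \in r & free_in x (F i).
Proof.
elim: r => [[[]//]|i r IH] /= [l]; rewrite /pair_family; case: ifP => _ h.
  by exists i; rewrite ?mem_head.
by have [j jr hj] := IH h; exists j; rewrite // inE jr orbT.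
Qed.

Lemma separation_sentence k : sentence (separation k).
Proof.
apply: below_sentence; apply: (proj1 (below_block _)); rewrite add0n.
move=> x /free_in_fmins[[i j]]; rewrite mem_filter => /andP[_ /allpairsP[[i' j'] /=]].
by rewrite !mem_iota add0n /= => -[hi hj [-> ->]] /orP[] /eqP ->.
Qed.

Lemma separation_le (A : cstarAlgType R) k (c : R) :
  (forall g : nat -> A, in_ball g -> exists i j, (i < j < k)%N /\ rnorm (g i - g j) <= c) ->
  value A (separation k) <= c.
Proof.
move=> h; apply: fsups_le => [|g gb]; first exact: in_ball0.
have [i [j [/andP[ij jk] hij]]] := h g gb.
have ik := ltn_trans ij jk.
have ijr : (i, j) \in [seq ij <- [seq (i, j) | i <- iota 0 k, j <- iota 0 k] | (ij.1 < ij.2)%N].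
  rewrite mem_filter /= ij; apply/allpairsP; exists (i, j).
  by rewrite !mem_iota !add0n /= ik jk.
apply: le_trans (fmins_le _ _ _ ijr) _.
by rewrite [feval _ _]/(rnorm _) peval_sub /= /override !mem_iota !add0n /= ik jk.
Qed.

Lemma separation_ge (A : cstarAlgType R) k (c : R) (g : nat -> A) : c <= 2 ->
  in_ball g -> (forall i j, (i < j < k)%N -> c <= rnorm (g i - g j)) ->
  c <= value A (separation k).
Proof.
move=> c2 gb h; apply: le_trans (fsups_ub _ _ (@in_ball0 A) gb).
apply: fmins_ge => // -[i j]; rewrite mem_filter /= => /andP[ij].
case/allpairsP => -[i' j'] /=; rewrite !mem_iota !add0n /= => -[ik jk [ei ej]].
rewrite -ei in ik; rewrite -ej in jk.
rewrite scaleN1r /override !mem_iota !add0n /= ik jk; apply: h; by rewrite ij jk.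
Qed.

(** All that is used of pseudomatriciality: every sentence has its value
    approximated by its values in matrix algebras of arbitrarily large size. *)
Definition matrix_limit (A : cstarAlgType R) := forall phi : formula R, sentence phi ->
  forall (N : nat) (eps : R), 0 < eps -> exists n,
    [/\ (N <= n)%N, (0 < n)%N &
        `|value A phi - value (matalg R n : cstarAlgType R) phi| <= eps].

(** The sizes tend to infinity along the ultrafilter: the separation sentences
    tell an algebra of infinite dimension, where their values are at least 1/2,
    from matrix algebras of bounded size, where they are at most 1/4 once [k] is
    large. *)
Lemma pseudomatricial_limit (A : cstarAlgType R) :
  ~ finite_dimensional A -> pseudomatricial A -> matrix_limit A.
Proof.
move=> nfd [J [U [UU [n [n0 eqv]]]]].
have lim (phi : formula R) : sentence phi ->
    value (matalg R (n j) : cstarAlgType R) phi @[j --> U] --> value A phi.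
  move=> sphi; rewrite (eqv _ sphi).
  have := @los R J (fun j => matalg R (n j) : cstarAlgType R) U UU phi (fun=> 0).
  have -> : (fun _ : nat => upi UU 0) = (fun _ => 0 : ultraprod (fun j => matalg R (n j) : cstarAlgType R) UU).
    by apply: funext => _; rewrite -(subrr 0) upiB subrr.
  by apply => x j; rewrite rnorm0.
have near (phi : formula R) (eps : R) : sentence phi -> 0 < eps ->
    U [set j | `|value A phi - value (matalg R (n j) : cstarAlgType R) phi| <= eps].
  move=> sphi eps0.
  have [+ _] := @cvgrPdist_le R R J U _
    (fun j => value (matalg R (n j) : cstarAlgType R) phi) (value A phi).
  by move=> /(_ (lim _ sphi) _ eps0).
have large N : U [set j | (N <= n j)%N].
  have [//|small] := in_ultra_setVsetC [set j | (N <= n j)%N] UU.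
  have /choice[K hK] := fun d => matrix_ball_close_points R d.
  pose k := \max_(d < N) K d.
  have eps0 : 0 < 8^-1 :> R by rewrite invr_gt0.
  have [j [/= nj hj]] := filter_ex (filterI small (near _ _ (@separation_sentence k) eps0)).
  move/negP: nj; rewrite -ltnNge => nj.
  have : value (matalg R (n j) : cstarAlgType R) (separation k) <= 4^-1.
    apply: separation_le => g gb; apply: hK gb.
    exact: (leq_bigmax (Ordinal nj)).
  have [g [gb gs]] := separated_points nfd k.
  have c2 : 2^-1 <= 2 :> R by lra.
  by move=> /(le_dist_trans hj); rewrite leNgt (lt_le_trans _ (separation_ge c2 gb gs))//; lra.
move=> phi sphi N eps eps0.
have [j [/= h1 h2]] := filter_ex (filterI (large N) (near _ _ sphi eps0)).
by exists (n j).
Qed.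

Lemma matrix_limit_le (A : cstarAlgType R) (phi : formula R) (N : nat) (c : R) :
  matrix_limit A -> sentence phi ->
  (forall n, (N <= n)%N -> (0 < n)%N ->
     value (matalg R n : cstarAlgType R) phi <= c) ->
  value A phi <= c.
Proof.
move=> lim sphi h; apply/ler_addgt0Pr => e e0.
have [n [Nn n0 hn]] := lim _ sphi N e e0; exact: le_dist_trans hn (h n Nn n0).
Qed.

End matrix_limits.

(** * Sentences that hold in matrix algebras *)

Section matrix_projections.
Variables (R : realType) (n : nat).
Local Notation Mn := (matalg R n : cstarAlgType R).

Lemma matalg_cmulE (x y : Mn) : x ** y = (x : 'M_n) *m (y : 'M_n).
Proof. by []. Qed.

Lemma matalg_cstarE (x : Mn) : cstar x = mxadj (x : 'M_n).
Proof. by []. Qed.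

(** The adjoint of a rectangular matrix; for columns, [w *m coladj v] is the rank
    one operator of [w] and [v], and [coladj v *m w] their inner product. *)
Definition coladj m (w : 'M[R[i]]_(n, m)) : 'M[R[i]]_(m, n) := map_mx Num.conj w^T.

Lemma coladjM (w v : 'cV[R[i]]_n) :
  mxadj (w *m coladj v) = v *m coladj w.
Proof.
rewrite /mxadj /coladj trmx_mul map_mxM; congr (_ *m _).
by apply/matrixP => i j; rewrite !mxE /= conjCK.
Qed.

Lemma coladj_norm (w : 'cV[R[i]]_n) : coladj w *m w = ((l2norm w) ^+ 2)%:C%:M.
Proof.
apply/matrixP => i j; rewrite !ord1 !mxE eqxx mulr1n /l2norm sqr_sqrtr; last first.
  by rewrite sumr_ge0// => k _; rewrite sqr_ge0.
rewrite rmorph_sum; apply: eq_bigr => k _.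
by rewrite !mxE rmorphXn /= rnormE normCK mulrC.
Qed.

(** Let [xi] be a unit vector in the range of [p <> 0], and [q] the projection onto
    its line, a subprojection of [p].  If [q = p], the operators that map [xi] to
    the vectors of the standard basis are partial isometries with initial
    projection [p] and orthogonal ranges. *)
Lemma matrix_projection_cases (N : nat) (p : Mn) : (N <= n)%N -> projection p ->
  [\/ p = 0,
      exists q, [/\ subprojection q p, q <> 0 & q <> p] |
      exists v : nat -> Mn, in_ball v /\ forall i j : 'I_N,
        cstar (v i) ** v j = if i == j then p else 0].
Proof.
move=> Nn pproj; have [sp pp] := pproj.
have [->|p0] := eqVneq p 0; first exact: Or31.
have [k hk] : exists k, col k (p : 'M_n) != 0.
  apply: contrapT => no; move/eqP: p0; apply; apply/matrixP => i j.
  have /eqP/colP/(_ i) : col j (p : 'M_n) == 0.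
    by apply: contrapT => /negP h; apply: no; exists j.
  by rewrite !mxE.
set w := col k (p : 'M_n) in hk *; have pw : (p : 'M_n) *m w = w.
  by rewrite /w colE mulmxA -matalg_cmulE pp.
have w0 : 0 < l2norm w.
  by rewrite lt0r l2norm_ge0 andbT; apply: contra hk => /eqP/l2norm_eq0 ->.
pose xi := (l2norm w)^-1%:C *: w.
have xi1 : coladj xi *m xi = 1%:M.
  rewrite coladj_norm l2normZ rnorm_real ?invr_ge0 ?(ltW w0)//.
  by rewrite mulVf ?gt_eqF// expr1n.
have pxi : (p : 'M_n) *m xi = xi by rewrite -scalemxAr pw.
pose q : Mn := xi *m coladj xi.
have qproj : projection q.
  split; first by rewrite matalg_cstarE coladjM.
  by rewrite matalg_cmulE /q mulmxA -[X in X *m _]mulmxA xi1 mulmx1.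
have q0 : q <> 0.
  move=> q0; have : (q : 'M_n) *m xi = xi by rewrite /q -mulmxA xi1 mulmx1.
  rewrite q0 mul0mx => xi0; move: xi1; rewrite -xi0 mulmx0 => /matrixP/(_ 0 0).
  by rewrite !mxE eqxx => /esym/eqP; rewrite oner_eq0.
have [qp|/eqP qp] := eqVneq q p; last first.
  by apply: Or32; exists q; split=> //; split=> //; rewrite matalg_cmulE /q mulmxA pxi.
apply: Or33.
pose v (i : nat) : Mn :=
  if insub i is Some i' then (delta_mx (widen_ord Nn i') 0 : 'cV_n) *m coladj xi else 0.
have vv (i j : 'I_N) : cstar (v i) ** v j = if i == j then p else 0.
  rewrite /v !valK matalg_cstarE matalg_cmulE coladjM mulmxA -[X in X *m _]mulmxA.
  have -> : coladj (delta_mx (widen_ord Nn i) 0 : 'cV[R[i]]_n) *m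
            (delta_mx (widen_ord Nn j) 0 : 'cV_n) = (i == j)%:R%:M.
    apply/matrixP => a b; rewrite !ord1 !mxE (bigD1 (widen_ord Nn i))//= !mxE !eqxx.
    rewrite rmorph1 mul1r big1 => [|c ci]; last first.
      by rewrite !mxE (negPf ci) rmorph0 mul0r.
    by rewrite addr0 andbT mulr1n.
  rewrite -qp /q mul_mx_scalar -scalemxAl.
  by case: eqP => _; rewrite ?scale1r ?scale0r.
exists v; split=> // x; case: (ltnP x N) => xN; last by rewrite /v insubN -?leqNgt// rnorm0.
rewrite -(expr_le1 (n := 2))// ?rnorm_ge0// -rnorm_cstarM.
rewrite -[x]/(nat_of_ord (Ordinal xN)) vv eqxx; exact: projection_ball.
Qed.

End matrix_projections.

Section sentences.
Variable R : realType.
Local Notation X := (PVar R).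

Definition unit_body (x y : nat) : formula R :=
  fadd (FNorm (PSub (PMul (X x) (X y)) (X y))) (FNorm (PSub (PMul (X y) (X x)) (X y))).

Definition unital_sentence : formula R := FInf 0 (FSup 1 (unit_body 0 1)).

Lemma feval_unit_body (A : cstarAlgType R) (e : nat -> A) x y :
  feval (unit_body x y) e =
  rnorm (e x ** e y - e y) + rnorm (e y ** e x - e y).
Proof.
rewrite /unit_body feval_fadd ![feval (FNorm _) _]/(rnorm _).
by rewrite !peval_sub.
Qed.

Lemma below_unit_body k x y : (x < k)%N -> (y < k)%N -> below k (unit_body x y).
Proof.
move=> xk yk; apply: below_conn; apply: below_pair; apply: below_norm => z /=.
all: by do ![case/orP|move/eqP ->].
Qed.

Lemma unital_sentenceP : sentence unital_sentence.
Proof.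
apply: below_sentence; apply: (proj2 (below_quant _)).
by apply: (proj1 (below_quant _)); exact: below_unit_body.
Qed.

Lemma matalg_unital n : value (matalg R n : cstarAlgType R) unital_sentence <= 0.
Proof.
have one : projection ((1%:M : 'M_n) : (matalg R n : cstarAlgType R)).
  split; last by rewrite matalg_cmulE mulmx1.
  by rewrite matalg_cstarE /mxadj trmx1 map_mx1.
apply: le_trans (finf_lb _ _ (in_ball0 _) (projection_ball one)) _.
apply: fsup_le => a _; rewrite feval_unit_body /update /= !matalg_cmulE.
by rewrite mul1mx mulmx1 subrr rnorm0 addr0.
Qed.

Definition square x : starpoly R := PMul (PStar (X x)) (X x).

(** Here [p] is minimal in the sense that the norm is multiplicative on the corner
    [p A p].  This is stable under perturbation, and excludes subprojections [q]
    other than 0 and [p], for which [q (p - q) = 0].  Writing [p] as a square makes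
    it self-adjoint. *)
Definition minimal_body : formula R :=
  let p := square 0 in
  let cut P := PMul p (PMul P p) in
  fadd (FNorm (PSub (PMul p p) p))
  (fadd (fdist (FNorm p) 1)
   (fdist (fadd (fmul (FNorm (cut (X 1))) (FNorm (cut (X 2))))
                (fscale (-1) (FNorm (PMul (cut (X 1)) (cut (X 2)))))) 0)).

Definition minimal_sentence := FInf 0 (FSup 1 (FSup 2 minimal_body)).

Lemma feval_minimal_body (A : cstarAlgType R) (e : nat -> A)
    (p := cstar (e 0%N) ** e 0%N) (cut := fun x => p ** (x ** p)) :
  feval minimal_body e =
  rnorm (p ** p - p) + (`|rnorm p - 1| +
    `|rnorm (cut (e 1%N)) * rnorm (cut (e 2)) - rnorm (cut (e 1%N) ** cut (e 2))|).
Proof.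
rewrite /minimal_body !feval_fadd !feval_fdist feval_fadd feval_fmul feval_fscale.
by rewrite ![feval (FNorm _) _]/(rnorm _) !peval_sub mulN1r subr0.
Qed.

Lemma minimal_sentenceP : sentence minimal_sentence.
Proof.
apply: below_sentence; apply: (proj2 (below_quant _)).
apply: (proj1 (below_quant _)); apply: (proj1 (below_quant _)).
repeat (first [apply: below_conn => ?; apply: below_pair | apply: below_conn => ?]).
all: apply: below_norm => z /=; by do ![case/orP|move/eqP ->].
Qed.

Lemma matalg_minimal n : (0 < n)%N ->
  value (matalg R n : cstarAlgType R) minimal_sentence <= 0.
Proof.
move=> n0; pose i := Ordinal n0.
pose p : (matalg R n : cstarAlgType R) := (delta_mx i i : 'M_n).
have pproj : projection p.
  split; last by rewrite matalg_cmulE mul_delta_mx.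
  apply/matrixP => a b; rewrite matalg_cstarE !mxE andbC.
  by case: andP; rewrite ?rmorph1 ?rmorph0.
have p0 : p <> 0.
  by move=> /matrixP/(_ i i); rewrite !mxE !eqxx => /eqP; rewrite oner_eq0.
have [sp pp] := pproj.
have corner (x : matalg R n : cstarAlgType R) : p ** (x ** p) = (x : 'M_n) i i *: p.
  apply/matrixP => a b; rewrite !matalg_cmulE !mxE (bigD1 i)//= !mxE (bigD1 i)//= !mxE !eqxx.
  rewrite !big1 => [|c ci|c ci]; rewrite ?mxE ?(negPf ci) ?andbF ?mul0r ?mulr0//.
  rewrite !addr0 /=; case: (a == i); case: (b == i); rewrite /= ?mulr1 ?mul1r ?mulr0 ?mul0r//.
apply: le_trans (finf_lb _ _ (in_ball0 _) (projection_ball pproj)) _.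
apply: fsup_le => x _; apply: fsup_le => y _.
rewrite feval_minimal_body /update /= sp !pp !corner subrr rnorm0 add0r.
rewrite cmulZl cmulZr pp !rnormZ projection_norm// !mulr1 !subrr !normr0 addr0.
by [].
Qed.

(** The sentence below says that every projection [p] is 0, or is cut by a proper
    subprojection [q], or has [N] orthogonal copies [v i p (v i)^*].  The three
    alternatives are the three terms of a minimum.  As the quantifier over [p]
    ranges over all [x^* x], the defect of [p] is subtracted with a factor which
    dominates the effect of replacing [p] by a projection at distance 8 times the
    defect: two terms of the second alternative, and [N^2] terms of the third,
    change by at most this distance. *)

Section copies.
Variable N : nat.

Definition copies_body : formula R :=
  let p := square 0 in let q := square 1 in
  fadd (fmin (FNorm p)
     (fmin (fadd (FNorm (PSub (PMul q q) q)) (fadd (FNorm (PSub (PMul p q) q))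
             (fadd (fdist (FNorm q) 1) (fdist (FNorm (PSub p q)) 1))))
           (fsum (index_enum ('I_N * 'I_N)%type) (fun ij =>
              let vv := PMul (PStar (X ij.1.+2)) (X ij.2.+2) in
              FNorm (if ij.1 == ij.2 then PSub vv p else vv)))))
   (fscale (- (16 + 8 * (N * N)%:R)) (FNorm (PSub (PMul p p) p))).

Definition copies_sentence : formula R :=
  FSup 0 (FInf 1 (finfs (iota 2 N) copies_body)).

Definition copies_excess (A : cstarAlgType R) (p q : A) (v : nat -> A) : R :=
  Num.min (rnorm p)
   (Num.min (rnorm (q ** q - q) + (rnorm (p ** q - q) +
              (`|rnorm q - 1| + `|rnorm (p - q) - 1|)))
      (\sum_(ij : 'I_N * 'I_N)
         rnorm (cstar (v ij.1) ** v ij.2 - if ij.1 == ij.2 then p else 0))).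

Lemma feval_copies_body (A : cstarAlgType R) (e : nat -> A) (p q : A) (v : nat -> A) :
  cstar (e 0%N) ** e 0%N = p -> cstar (e 1%N) ** e 1%N = q ->
  (forall i : 'I_N, e i.+2 = v i) ->
  feval copies_body e =
  copies_excess p q v - (16 + 8 * (N * N)%:R) * rnorm (p ** p - p).
Proof.
move=> <- <- ev.
rewrite /copies_body feval_fadd !feval_fmin !feval_fadd !feval_fdist feval_fscale.
rewrite feval_fsum ![feval (FNorm _) _]/(rnorm _) !peval_sub mulNr.
congr (Num.min _ (Num.min _ _) - _); apply: eq_bigr => -[i j] _ /=.
by rewrite -!ev; case: (i == j); rewrite /= ?scaleN1r ?subr0.
Qed.

Lemma copies_sentenceP : sentence copies_sentence.
Proof.
apply: below_sentence; apply: (proj1 (below_quant _)).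
apply: (proj2 (below_quant _)); apply: (proj2 (below_block _)).
repeat (first [apply: below_conn => ?; apply: below_pair | apply: below_conn => ?
             | apply: below_fsum => -[i j] ]).
all: apply: below_norm => z /=.
all: try by do ![case/orP|move/eqP ->].
have ltN (k : 'I_N) : (k.+2 < 2 + N)%N by rewrite add2n !ltnS ltn_ord.
by case: ifP => _ /=; do ![case/orP|move/eqP ->].
Qed.

Lemma copies_excess_le (A : cstarAlgType R) (a : A) :
  (forall p : A, projection p ->
    [\/ p = 0,
        exists q, [/\ subprojection q p, q <> 0 & q <> p] |
        exists v : nat -> A, in_ball v /\ forall i j : 'I_N,
          cstar (v i) ** v j = if i == j then p else 0]) ->
  rnorm a <= 1 ->
  exists z : A, rnorm z <= 1 /\ exists v : nat -> A, in_ball v /\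
    (let y := cstar a ** a in
    copies_excess y (cstar z ** z) v <= (16 + 8 * (N * N)%:R) * rnorm (y ** y - y)).
Proof.
move=> cases a1; pose y := cstar a ** a; rewrite -/y /=.
have y1 : rnorm y <= 1.
  by rewrite rnorm_cstarM expr_le1// rnorm_ge0.
set d := rnorm (y ** y - y).
have d0 : 0 <= d := rnorm_ge0 _.
have NN0 : 0 <= (N * N)%:R :> R := ler0n _ _.
(* A large defect outweighs the first term, which is at most 1. *)
have [d8|d8] := leP d 8^-1; last first.
  exists 0; split; first by rewrite rnorm0.
  exists (fun=> 0); split; first exact: in_ball0.
  by rewrite /copies_excess ge_min (le_trans y1)//; nra.
have [p [pproj py _]] := projection_near (cstar_cstarM a) d8 (lexx _).
rewrite -/y in py.
case: (cases _ pproj) => [p0|[q [[[sq qq] pq] q0 qp]]|[v [vb vv]]].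
- exists 0; split; first by rewrite rnorm0.
  exists (fun=> 0); split; first exact: in_ball0.
  by rewrite /copies_excess ge_min; move: py; rewrite p0 sub0r rnormN => py; rewrite (le_trans py)//; nra.
- exists q; split; first exact: projection_ball.
  exists (fun=> 0); split; first exact: in_ball0.
  rewrite /copies_excess sq !qq subrr rnorm0 add0r !ge_min; apply/orP; right; apply/orP; left.
  have [qp' pqproj] := subprojectionB pproj (conj (conj sq qq) pq).
  have nq : rnorm q = 1 by apply: projection_norm.
  have npq : rnorm (p - q) = 1.
    by apply: projection_norm => // /eqP; rewrite subr_eq0 => /eqP/esym.
  rewrite nq subrr normr0 add0r.
  have h1 : rnorm (y ** q - q) <= 8 * d.
    rewrite -[X in _ - X]pq -cmulBl; apply: le_trans (rnormM_le1r _ _) _.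
      by rewrite nq.
    by rewrite rnormB.
  have h2 : `|rnorm (y - q) - 1| <= 8 * d.
    rewrite -[X in _ - X]npq ler_distl; apply/andP; split.
      rewrite lerBlDr; apply: le_trans (rnorm_dist _ (y - q)) _.
      by rewrite lerD2l opprB addrA subrK.
    apply: le_trans (rnorm_dist _ (p - q)) _.
    by rewrite lerD2l opprB addrA subrK rnormB.
  nra.
exists 0; split; first by rewrite rnorm0.
exists v; split=> //.
rewrite /copies_excess !ge_min; apply/orP; right; apply/orP; right.
apply: (@le_trans _ _ (\sum_(ij : 'I_N * 'I_N) 8 * d)).
  apply: ler_sum => -[i j] _ /=; rewrite vv; case: ifP => _; first exact: py.
  by rewrite subr0 rnorm0 mulr_ge0.
rewrite sumr_const card_prod !card_ord -mulr_natr; nra.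
Qed.

Lemma matalg_copies n : (N <= n)%N ->
  value (matalg R n : cstarAlgType R) copies_sentence <= 0.
Proof.
move=> Nn; apply: fsup_le => a a1.
have ab : in_ball (update (fun=> 0 : (matalg R n : cstarAlgType R)) 0 a).
  exact: in_ball_update (in_ball0 _) a1.
have [z [z1 [v [vb hzv]]]] :=
  copies_excess_le (fun p => @matrix_projection_cases R n N p Nn) a1.
apply: le_trans (finf_lb _ _ ab z1) _.
have zb := in_ball_update 1 ab z1.
have vb' : in_ball (fun k => v k.-2) by move=> k; apply: vb.
apply: le_trans (finfs_lb _ _ zb vb') _.
rewrite (@feval_copies_body _ _ (cstar a ** a) (cstar z ** z) v) ?subr_le0//.
- by rewrite /override mem_iota.
- by rewrite /override mem_iota.
by move=> i; rewrite /override mem_iota add2n !ltnS ltn_ord.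
Qed.

End copies.
End sentences.

(** * Units and minimal projections *)

(** The arithmetic of [minimal_projection_exists]: there, cutting down changes the
    norm 1 of a projection by at most 16/200, and the norm 0 of the product of two
    orthogonal ones by at most 32/200. *)
Lemma minimal_gap (R : realType) (a b c x y : R) : 0 <= x -> 0 <= y ->
  184 * 200^-1 <= a -> 184 * 200^-1 <= b -> c <= 32 * 200^-1 ->
  ~ x + (y + `|a * b - c|) <= 200^-1.
Proof.
move=> x0 y0 ha hb hc; have := ler_norm (a * b - c).
have c0 : 0 <= 184 * 200^-1 :> R by rewrite mulr_ge0 ?invr_ge0 ?ler0n.
have := ler_pM c0 c0 ha hb; lra.
Qed.

Section limits_of_matrix_algebras.
Variables (R : realType) (A : cstarAlgType R).
Hypothesis lim : matrix_limit A.
Implicit Types (a b e p q x y z : A).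

Lemma approximate_unit (eps : R) : 0 < eps -> exists e, rnorm e <= 1 /\
  forall y, rnorm y <= 1 -> rnorm (e ** y - y) + rnorm (y ** e - y) <= eps.
Proof.
move=> eps0.
have v0 : feval (FInf 0 (FSup 1 (unit_body R 0 1))) (fun=> 0 : A) <= 0.
  exact: (@matrix_limit_le R A _ 0 0 lim (@unital_sentenceP R)
    (fun n _ _ => matalg_unital R n)).
have [e e1 he] := finf_lt (@in_ball0 R A) (le_lt_trans v0 eps0).
exists e; split=> // y y1; apply: le_trans (ltW he).
have := fsup_ub (unit_body R 0 1) 1 (in_ball_update 0 (@in_ball0 R A) e1) y1.
by rewrite feval_unit_body.
Qed.

(** Approximate units [u n], [u m] that are good for the whole unit ball are both
    close to [u n ** u m], so they form a Cauchy sequence. *)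
Lemma unit_exists : exists e, [/\ rnorm e <= 1, forall y, e ** y = y &
  forall y, y ** e = y].
Proof.
have half n : 0 < geom R n.+1 := geom_gt0 R n.+1.
have /choice[u hu] n := approximate_unit (half n).
have uu n m : rnorm (u n - u m) <= geom R n.+1 + geom R m.+1.
  have := (hu n).2 _ (hu m).1; have := (hu m).2 _ (hu n).1.
  have := rnormB_le (u n ** u m - u m) (u n ** u m - u n).
  rewrite opprB addrC subrKA.
  have := rnorm_ge0 (u m ** u n - u n); have := rnorm_ge0 (u m ** u n - u m).
  lra.
have [l hl] : exists l, forall n, rnorm (u n - l) <= geom R n *+ 2.
  apply: steps_cvg => n; apply: le_trans (uu _ _) _.
  by have := geom_gt0 R n.+2; rewrite (geomS R n) (geomS R n.+1); lra.
have ball_unit y : rnorm y <= 1 -> l ** y - y = 0 /\ y ** l - y = 0.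
  move=> y1; split; apply: (@rnorm_geom_eq0 _ _ _ 3) => n.
    have -> : l ** y - y = (u n ** y - y) - (u n - l) ** y.
      by rewrite cmulBl opprB [RHS]addrC subrKA.
    apply: le_trans (rnormB_le _ _) _.
    have := rnormM_le1r (u n - l) y1; have := (hu n).2 _ y1; have := hl n.
    have := rnorm_ge0 (y ** u n - y); have := geom_gt0 R n.+1; rewrite (geomS R n); lra.
  have -> : y ** l - y = (y ** u n - y) - y ** (u n - l).
    by rewrite cmulBr opprB [RHS]addrC subrKA.
  apply: le_trans (rnormB_le _ _) _.
  have := rnormM_le1 (u n - l) y1; have := (hu n).2 _ y1; have := hl n.
  have := rnorm_ge0 (u n ** y - y); have := geom_gt0 R n.+1; rewrite (geomS R n); lra.
have all_unit y : l ** y = y /\ y ** l = y.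
  have [->|y0] := eqVneq y 0; first by rewrite cmul0r cmulr0.
  have c0 : (rnorm y)^-1%:C != 0 :> R[i].
    by rewrite fmorph_eq0 invr_eq0 gt_eqF ?rnorm_gt0.
  have [|h1 h2] := ball_unit ((rnorm y)^-1%:C *: y).
    by rewrite rnorm_normalize.
  move: h1 h2; rewrite cmulZl cmulZr -!scalerBr => /eqP + /eqP.
  by rewrite !scaler_eq0 !(negPf c0) !subr_eq0 /= => /eqP -> /eqP ->.
exists l; split=> [|y|y]; [|exact: (all_unit y).1|exact: (all_unit y).2].
have sl : cstar l = l.
  by rewrite -[LHS](all_unit _).2 -{2}[l]cstarK -cstarM (all_unit _).2 cstarK.
by apply: projection_ball; split=> //; exact: (all_unit l).1.
Qed.

(** The sentence only yields an approximate projection [p0] on whose corner the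
    norm is approximately multiplicative.  A projection [p] near [p0] is minimal:
    for a proper subprojection [q], the norms of [q], [p - q] and their product
    are 1, 1 and 0, too far from multiplicativity. *)
Lemma minimal_projection_exists : exists p, minimal_projection p.
Proof.
have eps0 : 0 < 200^-1 :> R by rewrite invr_gt0.
have v0 : feval (FInf 0 (FSup 1 (FSup 2 (minimal_body R)))) (fun=> 0 : A) <= 0.
  exact: (@matrix_limit_le R A _ 0 0 lim (@minimal_sentenceP R)
    (fun n _ n0 => matalg_minimal R n0)).
have [x x1 hx] := finf_lt (@in_ball0 R A) (le_lt_trans v0 eps0).
pose p0 := cstar x ** x; pose cut y := p0 ** (y ** p0).
have p01 : rnorm p0 <= 1 by rewrite rnorm_cstarM expr_le1// rnorm_ge0.
have H y z : rnorm y <= 1 -> rnorm z <= 1 ->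
    rnorm (p0 ** p0 - p0) + (`|rnorm p0 - 1| +
    `|rnorm (cut y) * rnorm (cut z) - rnorm (cut y ** cut z)|) <= 200^-1.
  move=> y1 z1; apply: le_trans (ltW hx).
  have b1 := in_ball_update 0 (@in_ball0 R A) x1.
  apply: le_trans (fsup_ub _ _ b1 y1).
  apply: le_trans (fsup_ub _ _ (in_ball_update 1 b1 y1) z1).
  by rewrite feval_minimal_body.
have [h1 h2] : rnorm (p0 ** p0 - p0) <= 200^-1 /\ `|rnorm p0 - 1| <= 200^-1.
  have b0 : rnorm (0 : A) <= 1 by rewrite rnorm0.
  have := H 0 0 b0 b0; have := normr_ge0 (rnorm (cut 0) * rnorm (cut 0) - rnorm (cut 0 ** cut 0)).
  have := normr_ge0 (rnorm p0 - 1); have := rnorm_ge0 (p0 ** p0 - p0); split; lra.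
have d8 : 200^-1 <= 8^-1 :> R by rewrite lef_pV2 ?posrE ?ltr0n// ler_nat.
have [p [pproj hp _]] := projection_near (cstar_cstarM x) d8 h1.
rewrite -/p0 in hp; have [sp pp] := pproj.
have p1 := projection_ball pproj.
have cut_near q : rnorm q <= 1 -> p ** q = q -> q ** p = q ->
    rnorm (q - cut q) <= 16 * 200^-1.
  move=> q1 pq qp.
  have -> : q - cut q = (p - p0) ** q + p0 ** (q ** (p - p0)).
    by rewrite cmulBl pq !cmulBr qp addrA subrK.
  apply: le_trans (rnormD _ _) _.
  have := rnormM_le1r (p - p0) q1.
  have := rnormM_le1 (q ** (p - p0)) p01; have := rnormM_le1 (p - p0) q1; lra.
exists p; split=> //.
  move=> p_0; move: hp h2; rewrite p_0 sub0r rnormN ler_distl => hp /andP[h _].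
  lra.
move=> q qp; have [->|/eqP q0] := eqVneq q 0; first by left.
have [->|/eqP qnp] := eqVneq q p; first by right.
have [[sq qq] pq] := qp; have [qp' rproj] := subprojectionB pproj qp.
have nq : rnorm q = 1 by apply: projection_norm.
have nr : rnorm (p - q) = 1.
  by apply: projection_norm => // /eqP; rewrite subr_eq0 => /eqP/esym.
have q1 : rnorm q <= 1 by rewrite nq.
have r1 : rnorm (p - q) <= 1 by rewrite nr.
have cq := cut_near q q1 pq qp'.
have cr : rnorm (p - q - cut (p - q)) <= 16 * 200^-1.
  by apply: cut_near => //; rewrite ?cmulBr ?cmulBl pp ?pq ?qp'.
have qr : q ** (p - q) = 0 by rewrite cmulBr qp' qq subrr.
have c1 : rnorm (cut (p - q)) <= 1.
  by rewrite rnormM_ball// rnormM_ball.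
have prod : rnorm (cut q ** cut (p - q)) <= 32 * 200^-1.
  have -> : cut q ** cut (p - q) =
      - ((q - cut q) ** cut (p - q) + q ** (p - q - cut (p - q))).
    by rewrite cmulBl [q ** (_ - cut _)]cmulBr qr sub0r addrAC subrr sub0r opprK.
  rewrite rnormN; apply: le_trans (rnormD _ _) _.
  have := rnormM_le1r (q - cut q) c1; have := rnormM_le1 (p - q - cut (p - q)) q1.
  lra.
exfalso; apply: minimal_gap prod (H q (p - q) q1 r1); rewrite ?rnorm_ge0 ?normr_ge0//.
  by have := rnorm_dist q (cut q); rewrite nq; lra.
by have := rnorm_dist (p - q) (cut (p - q)); rewrite nr; lra.
Qed.

Lemma copies_exist (N : nat) p (eps : R) : 0 < eps -> projection p ->
  exists z, rnorm z <= 1 /\ exists v : nat -> A, in_ball v /\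
    copies_excess N p (cstar z ** z) v < eps.
Proof.
move=> eps0 pproj; have [sp pp] := pproj.
have v0 : feval (FSup 0 (FInf 1 (finfs (iota 2 N) (copies_body R N)))) (fun=> 0 : A) <= 0.
  exact: (@matrix_limit_le R A _ N 0 lim (@copies_sentenceP R N)
    (fun n Nn _ => @matalg_copies R N n Nn)).
have pb := in_ball_update 0 (@in_ball0 R A) (projection_ball pproj).
have h := fsup_ub (FInf 1 (finfs (iota 2 N) (copies_body R N))) 0 (@in_ball0 R A) (projection_ball pproj).
have [z z1 hz] := finf_lt pb (le_lt_trans (le_trans h v0) eps0).
have [g gb] := finfs_lt (in_ball_update 1 pb z1) hz.
rewrite (@feval_copies_body _ _ _ _ p (cstar z ** z) (fun k => g k.+2)).
- rewrite pp subrr rnorm0 mulr0 subr0 => hg.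
  by exists z; split=> //; exists (fun k => g k.+2); split=> // k; apply: gb.
- by rewrite /override mem_iota /= sp pp.
- by rewrite /override mem_iota.
by move=> i; rewrite /override mem_iota add2n !ltnS ltn_ord.
Qed.

End limits_of_matrix_algebras.

(** * Traces of minimal projections *)

Section minimal_projection_trace.
Variables (R : realType) (A : cstarAlgType R).
Implicit Types (a b e p q x y z : A).

(** An approximate subprojection [q] of [p] may be moved into the corner of [p], as
    [p q p], and then corrected to a subprojection there; by minimality this is 0
    or [p], so that [q] was close to 0 or to [p]. *)
Lemma minimal_no_cut p z : minimal_projection p -> rnorm z <= 1 ->
  let q := cstar z ** z in
  100^-1 <= rnorm (q ** q - q) +
    (rnorm (p ** q - q) + (`|rnorm q - 1| + `|rnorm (p - q) - 1|)).
Proof.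
move=> [pproj p0 pmin] z1 /=; set q := cstar z ** z; rewrite leNgt; apply/negP => small.
have [sp pp] := pproj; have p1 := projection_ball pproj.
have sq : cstar q = q by exact: cstar_cstarM.
have q1 : rnorm q <= 1 by rewrite rnorm_cstarM expr_le1// rnorm_ge0.
have [h1 h2 h3 h4] : [/\ rnorm (q ** q - q) <= 100^-1, rnorm (p ** q - q) <= 100^-1,
    `|rnorm q - 1| <= 100^-1 & `|rnorm (p - q) - 1| <= 100^-1].
  move: small; move: (rnorm_ge0 (q ** q - q)) (rnorm_ge0 (p ** q - q)).
  by move: (normr_ge0 (rnorm q - 1)) (normr_ge0 (rnorm (p - q) - 1)); split; lra.
pose q0 := p ** (q ** p).
have sq0 : cstar q0 = q0 by rewrite /q0 cstarM [cstar (q ** p)]cstarM sq sp cmulA.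
have q01 : rnorm q0 <= 1 by rewrite rnormM_ball// rnormM_ball.
have qp : rnorm (q ** p - q) <= 100^-1.
  by rewrite -cstar_norm cstarB [cstar (q ** p)]cstarM sp sq.
have q0q : rnorm (q0 - q) <= 2 * 100^-1.
  have -> : q0 - q = (p ** q - q) ** p + (q ** p - q).
    by rewrite cmulBl /q0 cmulA subrKA.
  by apply: le_trans (rnormD _ _) _; have := rnormM_le1r (p ** q - q) p1; lra.
have d8 : 7 * 100^-1 <= 8^-1 :> R.
  by rewrite ler_pdivrMr ?ltr0n// mulrC ler_pdivlMr ?ltr0n// -natrM ler_nat.
have idem : rnorm (q0 ** q0 - q0) <= 7 * 100^-1.
  have -> : q0 ** q0 - q0 = (q0 ** (q0 - q) + (q0 - q) ** q) + (q ** q - q) - (q0 - q).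
    rewrite cmulBr cmulBl subrKA subrKA opprB.
    by rewrite addrA subrK.
  have := rnormB_le (q0 ** (q0 - q) + (q0 - q) ** q + (q ** q - q)) (q0 - q).
  have := rnormD (q0 ** (q0 - q) + (q0 - q) ** q) (q ** q - q).
  have := rnormD (q0 ** (q0 - q)) ((q0 - q) ** q).
  have := rnormM_le1 (q0 - q) q01; have := rnormM_le1r (q0 - q) q1; lra.
have [r [rproj hr rfix]] := projection_near sq0 d8 idem.
have pr : p ** r = r by apply: rfix; rewrite /q0 cmulA pp.
move: h3 h4; rewrite !ler_distl => /andP[h3 _] /andP[h4 _].
have rq : rnorm (r - q) <= 58 * 100^-1.
  by rewrite -(subrKA q0) (le_trans (rnormD _ _))//; lra.
have [r0|rp] := pmin r (conj rproj pr).
  by move: rq; rewrite r0 sub0r rnormN; lra.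
by move: rq; rewrite rp; lra.
Qed.

Variable tr : {scalar A}.
Hypothesis trst : tracial_state tr.

(** As the supremum of an unbounded set is 0 by convention, the value 1 shows that
    [tr] is bounded. *)
Lemma tracial_state_bound a : rnorm (tr a) <= rnorm a.
Proof.
have [_ sup1 _] := trst.
have hs : has_sup [set rnorm (tr a) | a in unit_ball A].
  by apply: contrapT => /sup_out h; move: sup1; rewrite h => /eqP; rewrite eq_sym oner_eq0.
have ball b : rnorm b <= 1 -> rnorm (tr b) <= 1.
  by move=> b1; rewrite -[leRHS]sup1; apply: sup_upper_bound => //; exists b.
have [->|a0] := eqVneq a 0; first by rewrite linear0 rnorm0 rnorm_ge0.
have := ball ((rnorm a)^-1%:C *: a); rewrite rnorm_normalize// => /(_ (lexx _)).
rewrite linearZ /= rnormCM rnorm_real ?invr_ge0 ?rnorm_ge0//.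
by rewrite mulrC ler_pdivrMr ?rnorm_gt0// mul1r.
Qed.

(** With [w i = v i p], the sum [s] of the [N] approximate projections
    [w i (w i)^*], which are approximately orthogonal, is an approximate
    projection, so its trace is at most 2; but by the trace property its trace is
    close to [N tr p]. *)
Lemma trace_of_copies (N : nat) p (v : nat -> A) : projection p -> in_ball v ->
  \sum_(ij : 'I_N * 'I_N)
    rnorm (cstar (v ij.1) ** v ij.2 - if ij.1 == ij.2 then p else 0) <= 1 ->
  N%:R * rnorm (tr p) <= 3.
Proof.
move=> pproj vb; have [sp pp] := pproj; have p1 := projection_ball pproj.
pose eta (i j : 'I_N) := rnorm (cstar (v i) ** v j - if i == j then p else 0).
rewrite -(pair_bigA _ (fun i j => eta i j)) /= => eta1.
have [_ _ trC] := trst.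
pose w (i : 'I_N) := v i ** p.
have wb i : rnorm (w i) <= 1 by rewrite rnormM_ball//; apply: vb.
have ww i j : rnorm (cstar (w i) ** w j - if i == j then p else 0) <= eta i j.
  have -> : cstar (w i) ** w j - (if i == j then p else 0) =
      p ** (cstar (v i) ** v j - if i == j then p else 0) ** p.
    rewrite cmulBr cmulBl /w cstarM sp !cmulA; congr (_ - _).
    by case: (i == j); rewrite ?pp // cmulr0 cmul0r.
  by rewrite (le_trans (rnormM_le1r _ p1))// rnormM_le1.
have wp i : w i ** p = w i by rewrite /w -cmulA pp.
pose s := \sum_i w i ** cstar (w i).
have ss : cstar s = s.
  by rewrite /s cstar_sum; apply: eq_bigr => i _; rewrite cstarM cstarK.
have sdef : rnorm (s ** s - s) <= 1.
  have -> : s ** s - s = \sum_i \sum_j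
      w i ** (cstar (w i) ** w j - if i == j then p else 0) ** cstar (w j).
    have {3}-> : s = \sum_i \sum_j w i ** (if i == j then p else 0) ** cstar (w j).
      apply: eq_bigr => i _; rewrite (bigD1 i)//= eqxx wp big1 ?addr0// => j ji.
      by rewrite eq_sym (negPf ji) cmulr0 cmul0r.
    rewrite {1}/s cmul_suml -sumrB; apply: eq_bigr => i _.
    rewrite /s cmul_sumr -sumrB; apply: eq_bigr => j _.
    by rewrite cmulBr cmulBl !cmulA.
  apply: le_trans eta1; apply: le_trans (rnorm_sum _ _) _; apply: ler_sum => i _.
  apply: le_trans (rnorm_sum _ _) _; apply: ler_sum => j _.
  apply: le_trans (ww i j); apply: le_trans (rnormM_le1r _ _) _.
    by rewrite cstar_norm.
  exact: rnormM_le1.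
have s2 : rnorm s <= 2 by apply: rnorm_approx_projection ss sdef.
have trp : N%:R * tr p = tr s - \sum_i tr (cstar (w i) ** w i - p).
  rewrite /s linear_sum -sumrB /=.
  under eq_bigr do rewrite trC raddfB opprB addrC subrK.
  by rewrite sumr_const card_ord mulr_natl.
have -> : N%:R * rnorm (tr p) = rnorm (N%:R * tr p).
  by rewrite mulr_natl mulr_natl /rnorm normrMn raddfMn.
rewrite trp; apply: le_trans (rnormB_le _ _) _.
have h1 := le_trans (tracial_state_bound s) s2.
have h2 : rnorm (\sum_i tr (cstar (w i) ** w i - p)) <= 1.
  apply: le_trans eta1; apply: le_trans (rnorm_sum _ _) _; apply: ler_sum => i _.
  apply: le_trans (tracial_state_bound _) _.
  have := ww i i; rewrite eqxx => /le_trans; apply.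
  by rewrite (bigD1 i)//= lerDl sumr_ge0// => j _; exact: rnorm_ge0.
lra.
Qed.

Lemma minimal_trace0 p : matrix_limit A -> minimal_projection p -> tr p = 0.
Proof.
move=> lim pmin; have [pproj p0 _] := pmin.
have np := projection_norm pproj p0.
have bound N : N%:R * rnorm (tr p) <= 3.
  have eps0 : 0 < 100^-1 :> R by rewrite invr_gt0.
  have [z [z1 [v [vb]]]] := copies_exist lim N eps0 pproj.
  rewrite /copies_excess !gt_min np => /orP[|/orP[|]].
  - by rewrite ltNge invf_le1// ler1n.
  - by have /= := minimal_no_cut pmin z1; rewrite leNgt => /negbTE ->.
  move=> /ltW h; apply: trace_of_copies pproj vb _; apply: le_trans h _.
  by rewrite invf_le1// ler1n.
apply: rnorm_eq0; apply/eqP; apply: contrapT => /negP trp.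
have trp0 : 0 < rnorm (tr p) by rewrite lt0r trp rnorm_ge0.
have := bound (Num.trunc (3 / rnorm (tr p))).+1.
rewrite leNgt => /negP; apply; rewrite -ltr_pdivrMr//; exact: truncnS_gt.
Qed.

End minimal_projection_trace.

(** * A tracial state

    Finitely many relations between finitely many elements of [A] can be realized
    approximately in a matrix algebra.  An ultralimit of the normalized traces of
    such realizations is a tracial state on [A]. *)

Section normalized_trace.
Variables (R : realType) (n : nat).
Hypothesis n0 : (0 < n)%N.
Local Notation Mn := (matalg R n : cstarAlgType R).

Definition ntr (x : Mn) : R[i] := \tr (x : 'M_n) / n%:R.

Lemma ntrD (x y : Mn) : ntr (x + y) = ntr x + ntr y.
Proof. by rewrite /ntr [\tr _]mxtraceD mulrDl. Qed.

Lemma ntrZ (c : R[i]) (x : Mn) : ntr (c *: x) = c * ntr x.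
Proof. by rewrite /ntr [\tr _]mxtraceZ mulrA. Qed.

Lemma ntrB (x y : Mn) : ntr (x - y) = ntr x - ntr y.
Proof. by rewrite -scaleN1r ntrD ntrZ mulN1r. Qed.

Lemma ntrC (x y : Mn) : ntr (x ** y) = ntr (y ** x).
Proof. by rewrite /ntr !matalg_cmulE mxtrace_mulC. Qed.

Lemma natC_neq0 : n%:R != 0 :> R[i].
Proof. by rewrite pnatr_eq0 -lt0n. Qed.

Lemma ntr1 : ntr ((1%:M : 'M_n) : Mn) = 1.
Proof. by rewrite /ntr mxtrace1 divff// natC_neq0. Qed.

Lemma rnorm_natC_inv : rnorm (n%:R^-1 : R[i]) = n%:R^-1.
Proof.
by apply: (@complexI R); rewrite rnormE normfV normr_nat fmorphV rmorph_nat.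
Qed.

Lemma ntr_bound (x : Mn) : rnorm (ntr x) <= rnorm x.
Proof.
rewrite /ntr rnormCM rnorm_natC_inv ler_pdivrMr ?ltr0n//.
apply: le_trans (rnorm_sum _ _) _.
apply: (@le_trans _ _ (\sum_(i < n) rnorm x)).
  by apply: ler_sum => i _; exact: entry_le_opnorm.
by rewrite sumr_const card_ord mulr_natr.
Qed.

Lemma ntr_ge0 (x : Mn) : 0 <= ntr (cstar x ** x).
Proof.
rewrite /ntr mulr_ge0 ?invr_ge0 ?ler0n// sumr_ge0// => i _.
rewrite matalg_cmulE mxE sumr_ge0// => j _.
by rewrite !mxE mulrC -normCK exprn_ge0.
Qed.

End normalized_trace.

Section substitution.
Variable R : realType.
Implicit Types (P Q : starpoly R).

Fixpoint psubst (s : nat -> starpoly R) P : starpoly R :=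
  match P with
  | PVar x => s x
  | PAdd P Q => PAdd (psubst s P) (psubst s Q)
  | PScale c P => PScale c (psubst s P)
  | PMul P Q => PMul (psubst s P) (psubst s Q)
  | PStar P => PStar (psubst s P)
  end.

Fixpoint pvars P : seq nat :=
  match P with
  | PVar x => [:: x]
  | PAdd P Q | PMul P Q => pvars P ++ pvars Q
  | PScale _ P | PStar P => pvars P
  end.

Lemma peval_psubst (A : cstarAlgType R) (e : nat -> A) s P :
  peval e (psubst s P) = peval (fun x => peval e (s x)) P.
Proof.
elim: P => [x|P IHP Q IHQ|c P IH|P IHP Q IHQ|P IH] //=.
all: by rewrite ?IHP ?IHQ ?IH.
Qed.

Lemma eq_peval (A : cstarAlgType R) (e f : nat -> A) P :
  {in pvars P, e =1 f} -> peval e P = peval f P.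
Proof.
elim: P => [x|P IHP Q IHQ|c P IH|P IHP Q IHQ|P IH] h /=.
- by apply: h; rewrite mem_head.
- by rewrite IHP ?IHQ// => x hx; apply: h; rewrite mem_cat hx ?orbT.
- by rewrite IH.
- by rewrite IHP ?IHQ// => x hx; apply: h; rewrite mem_cat hx ?orbT.
by rewrite IH.
Qed.

Lemma pvar_in_psubst s P y : pvar_in y (psubst s P) -> exists x, pvar_in y (s x).
Proof.
elim: P => [x|P IHP Q IHQ|c P IH|P IHP Q IHQ|P IH] //=; first by exists x.
all: by case/orP.
Qed.

End substitution.

Section finite_representability.
Variables (R : realType) (A : cstarAlgType R).
Hypothesis lim : matrix_limit A.
Variable e : A.
Hypothesis unit_e : forall y, e ** y = y.

(** A *-polynomial together with the elements of [A] to be put for its variables: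
    a realization [f] has to respect the norm of its value. *)
Definition condition : Type := ((nat -> A) * starpoly R)%type.

Definition represents (L : seq condition) (eps : R) n
    (f : A -> (matalg R n : cstarAlgType R)) : Prop :=
  rnorm (f e - (1%:M : 'M_n)) <= eps /\
  forall c : condition, List.In c L ->
    `|rnorm (peval (f \o c.1) c.2) - rnorm (peval c.1 c.2)| <= eps.

Lemma sum_ge_In (I : Type) (r : seq I) (F : I -> R) i :
  (forall j, 0 <= F j) -> List.In i r -> F i <= \sum_(j <- r) F j.
Proof.
move=> F0; elim: r => //= j r IH; rewrite big_cons => -[->|/IH h].
  by rewrite lerDl sumr_ge0.
by rewrite (le_trans h)// lerDr.
Qed.

Lemma sum_In_eq0 (I : Type) (r : seq I) (F : I -> R) :
  (forall i, List.In i r -> F i = 0) -> \sum_(i <- r) F i = 0.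
Proof.
elim: r => [|j r IH] h; first by rewrite big_nil.
by rewrite big_cons h /= ?IH ?addr0; [|move=> i ir; apply: h; right|left].
Qed.

(** The existence of a realization is an approximate statement about the infimum of
    a formula whose value in [A] is 0, as the given elements attain it.  Since
    quantifiers range over the unit ball, the elements are divided by a bound [M]
    of their norms, which is multiplied back inside the polynomials. *)
Lemma finitely_representable (L : seq condition) (eps : R) : 0 < eps ->
  exists n, (0 < n)%N /\ exists f, @represents L eps n f.
Proof.
move=> eps0.
(* The unit is put first, so that it has the index 0. *)
pose ls : seq A := e :: flatten [seq [seq c.1 x | x <- pvars c.2] | c <- L].
have mem_ls (c : condition) x : List.In c L -> x \in pvars c.2 -> c.1 x \in ls.
  rewrite inE => cL xc; apply/orP; right.
  elim: (L) cL => //= d L' IH [->|/IH h]; rewrite mem_cat ?h ?orbT//.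
  by apply/orP; left; apply: map_f.
pose M : R := 1 + \sum_(a <- ls) rnorm a.
have M0 : 0 < M by rewrite ltr_pwDl// sumr_ge0// => a _; exact: rnorm_ge0.
have lsM i : rnorm (nth 0 ls i) <= M.
  have [ils|ils] := ltnP i (size ls); last by rewrite nth_default// rnorm0 ltW.
  rewrite /M (big_rem (nth 0 ls i)) ?mem_nth//= addrCA lerDl addr_ge0//.
  by rewrite sumr_ge0// => a _; exact: rnorm_ge0.
have rC : rnorm (M%:C^-1 : R[i]) = M^-1.
  by rewrite -fmorphV rnorm_real// invr_ge0 ltW.
have MC0 : M%:C != 0 :> R[i] by rewrite fmorph_eq0 gt_eqF.
pose k := size ls.
pose scaled (a : A) := PScale M%:C (PVar R (index a ls)).
pose poly (c : condition) := psubst (fun x => scaled (c.1 x)) c.2.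
pose body := fadd (FNorm (PSub (PMul (scaled e) (PVar R k)) (PVar R k)))
  (fsum L (fun c => fdist (FNorm (poly c)) (rnorm (peval c.1 c.2)))).
pose phi := finfs (iota 0 k) (FSup k body).
have bodyE (B : cstarAlgType R) (v : nat -> B) : feval body v =
    rnorm ((M%:C *: v 0%N) ** v k - v k) +
    \sum_(c <- L) `|rnorm (peval (fun x => M%:C *: v (index (c.1 x) ls)) c.2)
                    - rnorm (peval c.1 c.2)|.
  rewrite /body feval_fadd feval_fsum; congr (_ + _).
    by rewrite [feval _ _]/(rnorm _) peval_sub /= eqxx.
  by apply: eq_bigr => c _; rewrite feval_fdist [feval _ _]/(rnorm _) peval_psubst.
have sphi : sentence phi.
  apply: below_sentence; apply: (proj2 (below_block _)); rewrite add0n.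
  apply: (proj1 (below_quant _)); apply: below_conn; apply: below_pair.
    by apply: below_norm => z /=; rewrite eqxx; do ![case/orP|move/eqP ->].
  apply: below_fsum => c; apply: below_conn => _; apply: below_norm => z.
  by case/pvar_in_psubst => x /= /eqP ->; rewrite ltnS; exact: index_size.
have vA : value A phi <= 0.
  pose g i : A := M%:C^-1 *: nth 0 ls i.
  have gb : in_ball g.
    by move=> i; rewrite rnormZ rC mulrC ler_pdivrMr// mul1r.
  apply: le_trans (finfs_lb _ _ (@in_ball0 R A) gb) _.
  apply: fsup_le => y _; rewrite bodyE; set v := update _ _ _.
  have vi i : (i < k)%N -> M%:C *: v i = nth 0 ls i.
    move=> ik; rewrite /v /update (ltn_eqF ik) /override mem_iota /= add0n ik.
    by rewrite scalerA divff// scale1r.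
  rewrite vi// unit_e subrr rnorm0 add0r sum_In_eq0// => c cL.
  rewrite (@eq_peval _ _ _ c.1) ?subrr ?normr0// => x xc.
  have xls := mem_ls _ _ cL xc.
  by rewrite vi ?index_mem// nth_index.
have eps20 : 0 < eps / 2 by rewrite divr_gt0.
have [n [_ n0 hn]] := lim sphi 0 eps20.
have vn : value (matalg R n : cstarAlgType R) phi < eps.
  apply: (@le_lt_trans _ _ (0 + eps / 2)); last by lra.
  by apply: le_dist_trans vA; rewrite distrC.
have [g gb hg] := finfs_lt (@in_ball0 R _) vn.
exists n; split=> //; pose f (a : A) : (matalg R n : cstarAlgType R) := M%:C *: g (index a ls).
exists f.
have one1 : rnorm ((1%:M : 'M_n) : (matalg R n : cstarAlgType R)) <= 1.
  apply: opnorm_le_ub => v v1; by rewrite mul1mx.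
have vb : in_ball (override (fun=> 0 : (matalg R n : cstarAlgType R)) (iota 0 k) g).
  exact: in_ball_override (in_ball0 _) gb.
have := le_trans (fsup_ub body k vb one1) (ltW hg).
rewrite bodyE; set v := update _ _ _ => h.
have vi i : (i < k)%N -> v i = g i.
  by move=> ik; rewrite /v /update (ltn_eqF ik) /override mem_iota /= add0n ik.
have vk : v k = (1%:M : 'M_n) by rewrite /v /update eqxx.
have terms0 c : 0 <= `|rnorm (peval (fun x => M%:C *: v (index (c.1 x) ls)) c.2)
                    - rnorm (peval c.1 c.2)| by exact: normr_ge0.
split.
  apply: le_trans h; rewrite vk vi// matalg_cmulE mulmx1 /f /= eqxx.
  by rewrite lerDl sumr_ge0.
move=> c cL; apply: le_trans h.
apply: (@le_trans _ _ (\sum_(c <- L) `|rnorm (peval (fun x => M%:C *: v (index (c.1 x) ls)) c.2)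
                    - rnorm (peval c.1 c.2)|)); last by rewrite lerDr rnorm_ge0.
rewrite (@eq_peval _ _ (f \o c.1) (fun x => M%:C *: v (index (c.1 x) ls))).
  exact: (sum_ge_In terms0 cL).
move=> x xc; rewrite vi; first by [].
by rewrite /k index_mem; exact: mem_ls.
Qed.

(** The sets of functions [ntr \o f], for [f] a realization of given conditions
    with given precision, form a filter base; the limit is taken along an
    ultrafilter that contains them. *)
Lemma limit_of_traces : exists tau : A -> R[i],
  forall (L : seq condition) (as_ : seq A) (m : nat),
  exists n, (0 < n)%N /\ exists f, @represents L (geom R m) n f /\
    {in as_, forall a, rnorm (ntr (f a) - tau a) <= geom R m}.
Proof.
pose base (i : seq condition * nat) : set (A -> R[i]) :=
  [set t | exists n, (0 < n)%N /\ exists f, @represents i.1 (geom R i.2) n f /\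
    forall a, t a = ntr (f a)].
have geom_le m k : geom R (m + k) <= geom R m.
  by rewrite lef_pV2 ?posrE ?exprn_gt0// ler_weXn2l ?ler1n// leq_addr.
have filt : ProperFilter (filter_from [set: seq condition * nat] base).
  apply: filter_from_proper; last first.
    move=> [L m] _; have [n [n0 [f hf]]] := finitely_representable L (geom_gt0 R m).
    by exists (fun a => ntr (f a)), n; split=> //; exists f.
  apply: filter_fromT_filter; first by exists ([::], 0%N).
  move=> [L1 m1] [L2 m2]; exists (L1 ++ L2, (m1 + m2)%N).
  move=> t [n [n0 [f [[/= fe hf] tf]]]]; split; exists n; split=> //; exists f; split=> //.
    split=> [|c cL]; first exact: le_trans fe (geom_le _ _).
    by apply: le_trans (geom_le m1 m2); apply: hf; apply/List.in_app_iff; left.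
  rewrite addnC in fe hf.
  split=> [|c cL]; first exact: le_trans fe (geom_le _ _).
  by apply: le_trans (geom_le m2 m1); apply: hf; apply/List.in_app_iff; right.
have [G [UG subG]] := ultraFilterLemma filt.
have Gbase L m : G (base (L, m)) by apply: subG; exists (L, m).
have FG : Filter G by typeclasses eauto.
have ptlim a : exists z : R[i], forall m, G [set t | rnorm (t a - z) <= geom R m].
  have bnd : G [set t | rnorm (t a) <= rnorm a + 1].
    apply: (@filterS _ G _ _ _ _ (Gbase [:: (fun=> a, PVar R 0)] 0%N)).
    move=> t [n [n0 [f [[_ /(_ _ (or_introl erefl)) /= h'] tf]]]].
    move: h'; rewrite /= tf ler_distl => /andP[_ h]; apply: le_trans (ntr_bound n0 _) _.
    by apply: le_trans h _; rewrite /geom expr0 invr1.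
  have [r hr] : exists r : R, complex.Re (t a) @[t --> G] --> r.
    apply: (@ultra_bounded_cvg R _ G UG _ (rnorm a + 1)).
    by apply: (@filterS _ G _ _ _ _ bnd) => t /=; apply: le_trans (Re_le_rnorm _).
  have [s hs] : exists r : R, complex.Im (t a) @[t --> G] --> r.
    apply: (@ultra_bounded_cvg R _ G UG _ (rnorm a + 1)).
    by apply: (@filterS _ G _ _ _ _ bnd) => t /=; apply: le_trans (Im_le_rnorm _).
  exists (r +i* s)%C => m.
  have [+ _] := @cvgrPdist_le R R _ G _ (fun t => complex.Re (t a)) r.
  move=> /(_ hr _ (geom_gt0 R m.+1)) h1.
  have [+ _] := @cvgrPdist_le R R _ G _ (fun t => complex.Im (t a)) s.
  move=> /(_ hs _ (geom_gt0 R m.+1)) h2.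
  apply: (@filterS2 _ G _ _ _ _ _ h1 h2) => t /=; rewrite distrC [X in _ -> X <= _ -> _]distrC.
  case: (t a) => x y /= hx hy; apply: le_trans (rnormC_le _) _ => /=.
  by rewrite (geomS R m) mulr2n lerD.
have /choice[tau htau] := ptlim; exists tau => L as_ m.
have near_as : G [set t | {in as_, forall a, rnorm (t a - tau a) <= geom R m}].
  elim: as_ => [|a as_ IH].
    by apply: (@filterS _ G _ _ _ _ (Gbase [::] 0%N)) => t _ a; rewrite in_nil.
  apply: (@filterS2 _ G _ _ _ _ _ (htau a m) IH) => t /= h1 h2 b.
  by rewrite inE => /orP[/eqP ->|/h2].
have [t [[n [n0 [f [hf tf]]]] ht]] := filter_ex (filterI (Gbase L m) near_as).
exists n; split=> //; exists f; split=> // a /ht; by rewrite tf.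
Qed.

(** Each property of a tracial state is a relation between the values of the trace
    at finitely many elements, and is inherited approximately from the normalized
    traces.  The unit is sent near the identity matrix, so the limit is not 0. *)
Lemma tracial_state_exists : rnorm e <= 1 -> exists tr : {scalar A}, tracial_state tr.
Proof.
move=> e1; have [tau htau] := limit_of_traces.
have peq (B : cstarAlgType R) (x y : B) c : `|rnorm (x - y) - 0| <= c -> rnorm (x - y) <= c.
  by rewrite subr0 ger0_norm ?rnorm_ge0.
pose X := PVar R.
pose val2 (a b : A) := fun i : nat => if i is 0 then a else b.
pose val3 (a b c : A) := fun i : nat => if i is i'.+1 then val2 b c i' else a.
have tau_lin (c : R[i]) (a b : A) : tau (c *: a + b) = c * tau a + tau b.
  apply/eqP; rewrite eq_sym -subr_eq0; apply/eqP.
  apply: (@rnorm_geom_eq0 _ _ _ (rnorm c + 3)) => m.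
  pose P := PSub (PAdd (PScale c (X 0%N)) (X 1%N)) (X 2).
  have [n [n0 [f [[_ hf] ht]]]] := htau [:: (val3 a b (c *: a + b), P)] [:: a; b; c *: a + b] m.
  have := hf _ (or_introl erefl); rewrite /P !peval_sub /= subrr rnorm0 => /peq h.
  have ta := ht a (mem_head _ _); have tb : rnorm (ntr (f b) - tau b) <= geom R m.
    by apply: ht; rewrite !inE eqxx orbT.
  have tab : rnorm (ntr (f (c *: a + b)) - tau (c *: a + b)) <= geom R m.
    by apply: ht; rewrite !inE eqxx !orbT.
  have h' := le_trans (ntr_bound n0 _) h; rewrite ntrB ntrD ntrZ in h'.
  have -> : c * tau a + tau b - tau (c *: a + b) =
      (c * ntr (f a) + ntr (f b) - ntr (f (c *: a + b)))
      + (ntr (f (c *: a + b)) - tau (c *: a + b))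
      - (c * (ntr (f a) - tau a) + (ntr (f b) - tau b)) by ring.
  apply: le_trans (rnormB_le _ _) _.
  have cta : rnorm (c * (ntr (f a) - tau a)) <= rnorm c * geom R m.
    by rewrite rnormCM ler_wpM2l ?rnorm_ge0.
  apply: le_trans (lerD (le_trans (rnormD _ _) (lerD h' tab))
    (le_trans (rnormD _ _) (lerD cta tb))) _.
  by rewrite [X in X <= _](_ : _ = (rnorm c + 3) * geom R m)//; ring.
have tau_tr a b : tau (a ** b) = tau (b ** a).
  apply/eqP; rewrite -subr_eq0; apply/eqP; apply: (@rnorm_geom_eq0 _ _ _ 4) => m.
  pose P := PSub (PMul (X 0%N) (X 1%N)) (X 2).
  have [n [n0 [f [[_ hf] ht]]]] := htau [:: (val3 a b (a ** b), P); (val3 b a (b ** a), P)]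
    [:: a ** b; b ** a] m.
  have := hf _ (or_introl erefl); rewrite /P !peval_sub /= subrr rnorm0 => /peq h1.
  have := hf _ (or_intror (or_introl erefl)); rewrite /P !peval_sub /= subrr rnorm0 => /peq h2.
  have {}h1 := le_trans (ntr_bound n0 _) h1; rewrite ntrB in h1.
  have {}h2 := le_trans (ntr_bound n0 _) h2; rewrite ntrB ntrC in h2.
  have t1 := ht (a ** b) (mem_head _ _).
  have t2 : rnorm (ntr (f (b ** a)) - tau (b ** a)) <= geom R m.
    by apply: ht; rewrite !inE eqxx orbT.
  have -> : tau (a ** b) - tau (b ** a) =
      (ntr (f (b ** a)) - tau (b ** a)) + (ntr (f a ** f b) - ntr (f (b ** a)))
      - ((ntr (f a ** f b) - ntr (f (a ** b))) + (ntr (f (a ** b)) - tau (a ** b))) by ring.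
  apply: le_trans (rnormB_le _ _) _.
  apply: le_trans (lerD (le_trans (rnormD _ _) (lerD t2 h2))
    (le_trans (rnormD _ _) (lerD h1 t1))) _.
  by rewrite [X in X <= _](_ : _ = 4 * geom R m)//; ring.
have tau_pos a : 0 <= tau (cstar a ** a).
  set z := tau _.
  have near_pos m : exists2 w : R[i], 0 <= w & rnorm (w - z) <= 2 * geom R m.
    pose P := PSub (PMul (PStar (X 0%N)) (X 0%N)) (X 1%N).
    have [n [n0 [f [[_ hf] ht]]]] := htau [:: (val2 a (cstar a ** a), P)]
      [:: cstar a ** a] m.
    have := hf _ (or_introl erefl); rewrite /P !peval_sub /= subrr rnorm0 => /peq h.
    have {}h := le_trans (ntr_bound n0 _) h; rewrite ntrB in h.
    exists (ntr (cstar (f a) ** f a)); first exact: ntr_ge0.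
    rewrite -(subrKA (ntr (f (cstar a ** a)))).
    apply: le_trans (le_trans (rnormD _ _) (lerD h (ht _ (mem_head _ _)))) _.
    by rewrite [X in X <= _](_ : _ = 2 * geom R m)//; ring.
  have Imz : `|complex.Im z| <= 0.
    apply: (@le_geom_eps R _ _ 2) => m; rewrite add0r.
    have [w + hw] := near_pos m; rewrite lecE /= => /andP[/eqP Imw _].
    by apply: le_trans hw; apply: le_trans (Im_le_rnorm _); rewrite raddfB /= Imw sub0r normrN.
  rewrite lecE /= -normr_le0 Imz /= -oppr_le0.
  apply: (@le_geom_eps R _ _ 2) => m; rewrite add0r.
  have [w + hw] := near_pos m; rewrite lecE /= => /andP[_ Rew].
  apply: le_trans hw; apply: le_trans (Re_le_rnorm _); apply: le_trans (ler_norm _).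
  by rewrite raddfB /= lerDr.
have tau_bound a : rnorm (tau a) <= rnorm a.
  apply: (@le_geom_eps R _ _ 2) => m.
  have [n [n0 [f [[_ hf] ht]]]] := htau [:: (val2 a a, X 0%N)] [:: a] m.
  have := hf _ (or_introl erefl); rewrite /= ler_distl => /andP[_ h].
  have t := ht a (mem_head _ _); rewrite rnormB in t.
  apply: le_trans (rnorm_dist _ (ntr (f a))) _.
  apply: le_trans (lerD (le_trans (ntr_bound n0 _) h) t) _.
  by rewrite [X in X <= _](_ : _ = rnorm a + 2 * geom R m)//; ring.
have tau_e : tau e = 1.
  apply/eqP; rewrite -subr_eq0; apply/eqP; apply: (@rnorm_geom_eq0 _ _ _ 2) => m.
  have [n [n0 [f [[fe _] ht]]]] := htau [::] [:: e] m.
  have t := ht e (mem_head _ _); rewrite rnormB in t.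
  have := le_trans (ntr_bound n0 _) fe; rewrite ntrB ntr1// => h.
  rewrite -(subrKA (ntr (f e))); apply: le_trans (le_trans (rnormD _ _) (lerD t h)) _.
  by rewrite [X in X <= _](_ : _ = 2 * geom R m)//; ring.
pose tr : {scalar A} := HB.pack tau (@GRing.isLinear.Build R[i] A R[i] *%R tau tau_lin).
exists tr; split=> //=; apply/le_anti/andP; split.
  apply: ge_sup; first by exists (rnorm (tau 0)), 0; rewrite // /unit_ball /= rnorm0.
  by move=> _ [a a1 <-]; apply: le_trans (tau_bound a) a1.
apply: sup_upper_bound; last by exists e => //; rewrite tau_e /rnorm normr1.
split; first by exists (rnorm (tau 0)), 0; rewrite // /unit_ball /= rnorm0.
by exists 1 => _ [a a1 <-]; apply: le_trans (tau_bound a) a1.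
Qed.

End finite_representability.

(** * The ideal of a trace *)

Section trace_kernel.
Variables (R : realType) (A : cstarAlgType R).
Variable tr : {scalar A}.
Hypothesis trst : tracial_state tr.
Implicit Types (a b p x y : A).

Lemma affine_ge0_eq0 (K w : R[i]) : (forall t : R, 0 <= K + t%:C * w) -> w = 0.
Proof.
case: K w => [k k'] [u u'] h.
have := h 0; have := h 1; have := h (- (k + 1) / u).
rewrite !lecE /= => /andP[_ h3] /andP[/eqP h2 _] /andP[/eqP h1 _].
have u'0 : u' = 0 by lra.
suff u0 : u = 0 by rewrite u0 u'0.
apply/eqP; apply: contraT => u0; move: h3.
by rewrite mul0r subr0 divfK//; lra.
Qed.

(** Cauchy-Schwarz in the degenerate case: if [tr (y^* y) = 0], positivity on
    [x^* + c y] leaves an expression that is affine in [c], and hence constant. *)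
Lemma trace_null_mul x y : tr (cstar y ** y) = 0 -> tr (x ** y) = 0.
Proof.
move=> y0; have [pos _ _] := trst.
pose u := cstar x; set T := tr (x ** y); set S := tr (cstar y ** u).
have expand (c : R[i]) : 0 <= tr (cstar u ** u) + (c * T + c^* * S).
  have := pos (u + c *: y); rewrite cstarD cstarZ cmulDl !cmulDr !cmulZl !cmulZr.
  rewrite !linearD !linearZ /= y0 !mulr0 addr0 /u cstarK -/T -/S -addrA.
  by [].
have conj_real (t : R) : t%:C^* = t%:C by exact: conjc_real.
have TS : T + S = 0.
  apply: (@affine_ge0_eq0 (tr (cstar u ** u))) => t; have := expand t%:C.
  by rewrite conj_real mulrDr.
pose ii : R[i] := (0 +i* 1)%C.
have conj_ii : ii^* = - ii by apply/eqP; rewrite eq_complex /= oppr0 !eqxx.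
have conjc_M (z w : R[i]) : (z * w)^* = z^* * w^* by exact: rmorphM.
have ii0 : ii != 0 by rewrite eq_complex /= oner_eq0 andbF.
have TmS : ii * (T - S) = 0.
  apply: (@affine_ge0_eq0 (tr (cstar u ** u))) => t; have := expand (t%:C * ii).
  have -> : (t%:C * ii)^* = - (t%:C * ii) by rewrite conjc_M /= conj_real conj_ii mulrN.
  by rewrite mulNr -mulrBr mulrA.
move/eqP: TmS; rewrite mulf_eq0 (negPf ii0) subr_eq0 /= => /eqP TS'.
move: TS; rewrite -TS' -mulr2n => /eqP; rewrite mulrn_eq0 /= => /eqP.
exact.
Qed.

(** This is the left kernel [{a | tr (a^* a) = 0}] of the trace, in a form which makes
    it evidently a closed two-sided ideal. *)
Definition trace_ideal : set A := [set a | forall b, tr (b ** a) = 0].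

Lemma trace_ideal_closed_ideal : closed_ideal trace_ideal.
Proof.
have [_ _ trC] := trst.
split.
- move=> x clx b; apply: rnorm_eq0; apply/le_anti; rewrite rnorm_ge0 andbT.
  apply: (@le_geom_eps R _ _ (rnorm b)) => m; rewrite add0r.
  have g0 : 0 < (geom R m)%:C :> R[i] by rewrite ltcR geom_gt0.
  have [a [Ia]] := clx _ (nbhsx_ballx x _ g0).
  rewrite -ball_normE /= -rnormE ltcR => xa.
  have -> : tr (b ** x) = tr (b ** (x - a)).
    by rewrite cmulBr raddfB /= Ia subr0.
  apply: le_trans (tracial_state_bound trst _) _.
  by apply: le_trans (cstar_rnormM _ _) _; rewrite ler_wpM2l ?rnorm_ge0// ltW.
- by move=> b; rewrite cmulr0 linear0.
- by move=> a b Ia Ib c; rewrite cmulDr linearD /= Ia Ib addr0.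
- by move=> c a Ia b; rewrite cmulZr linearZ /= Ia mulr0.
by move=> a b Ia; split=> c; [rewrite cmulA trC cmulA Ia|rewrite cmulA Ia].
Qed.

End trace_kernel.

Theorem corollary6p4 (R : realType) (A : cstarAlgType R)
    (infinite_dim : ~ finite_dimensional A) (pm : pseudomatricial A) :
  (forall (p : A) (tr : {scalar A}),
      minimal_projection p -> tracial_state tr -> tr p = 0) /\
  (exists tr : {scalar A}, tracial_state tr /\ ~ faithful tr) /\
  ~ simple_cstar A.
Proof.
have lim := pseudomatricial_limit infinite_dim pm.
have null p (tr : {scalar A}) : minimal_projection p -> tracial_state tr -> tr p = 0.
  by move=> pmin trst; exact: (@minimal_trace0 R A tr trst p lim pmin).
have [e [e1 eL _]] := unit_exists lim.
have [p pmin] := minimal_projection_exists lim.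
have [tr trst] := tracial_state_exists lim eL e1.
have [[sp pp] p0 _] := pmin.
have pnull : tr (cstar p ** p) = 0 by rewrite sp pp; exact: null.
split; first exact: null.
split; first by exists tr; split=> // /(_ p pnull).
move=> /(_ _ (trace_ideal_closed_ideal trst)) [I0|I1].
  have : trace_ideal tr p by move=> b; exact: trace_null_mul.
  by rewrite I0 => /p0.
have [_ sup1 _] := trst.
have tr0 a : tr a = 0.
  have : trace_ideal tr a by rewrite I1.
  by move=> /(_ e); rewrite eL.
have img : [set rnorm (tr a) | a in unit_ball A] = [set 0].
  apply/seteqP; split=> [_ [a _ <-]|_ ->] /=; first by rewrite tr0 rnorm0.
  by exists 0; rewrite ?tr0 ?rnorm0//; exact: unit_ball0.
by move: sup1; rewrite img sup1 => /esym/eqP; rewrite oner_eq0.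
Qed.
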